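(* Let $q=\tanh g$ with $g\in\mathbb R$, and let $\psi\in\mathcal H_1$ be a vector in the holomorphic representation space of one degree of freedom. Let $$|\Phi_1\rangle=\pi^{-1/2}\,|\psi\rangle_0\otimes\sum_{n=0}^\infty q^n|n\rangle_1\otimes|n\rangle_2,\qquad\text{i.e.}\qquad \Phi_1(\bar u_0,\bar u_1,\bar u_2)=\pi^{-1/2}\psi(\bar u_0)e^{q\bar u_1\bar u_2}.$$ Then $|\Phi_1\rangle$ has the following expansion with respect to the generalized Bell basis $\big\{\pi^{-1/2}\sum_{m}(D(\alpha)|m\rangle_0)\otimes|m\rangle_1:\alpha\in\mathbb C\big\}$ of the variables $0,1$: $$|\Phi_1\rangle=\pi^{-3/2}\int_{\mathbb R^2}dx\,dp\ \sum_{m=0}^\infty(D(\alpha)|m\rangle_0)\otimes|m\rangle_1\otimes\sum_{n=0}^\infty q^n\,\langle n|D(\alpha)^\dagger|\psi\rangle\,|n\rangle_2,\qquad \alpha=x+ip,$$ as an identity between functions of $(\bar u_0,\bar u_1,\bar u_2)\in\mathbb C^3$.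
   Context: Holomorphic (Bargmann) representation with $n$ degrees of freedom: $\mathcal H_n$ is the Hilbert space of functions $f(\bar u)$, $\bar u=(\bar u_1,\dots,\bar u_n)$, that are entire holomorphic in $\bar u\in\mathbb C^n$ and square integrable with respect to $d\mu_n=\prod_{j}e^{-\bar u_ju_j}\frac{d\bar u_jdu_j}{2\pi i}$, where $\frac{d\bar u\,du}{2\pi i}$ denotes $\frac{1}{\pi}\,dx\,dy$ for $u=x+iy$. The inner product is $\langle f|g\rangle=\int\overline{f(\bar u)}g(\bar u)\,d\mu_n$, and tensor products correspond to products of functions in separate variables. Here three variables labelled $0,1,2$ are used, and subscripts on kets indicate the variable. In one degree of freedom, $|n\rangle=\bar u^n/\sqrt{n!}$ is the standard orthonormal basis. The displacement operator is the unitary operator $(D(\alpha)f)(\bar u)=e^{-|\alpha|^2/2}e^{\alpha\bar u}f(\bar u-\bar\alpha)$, $\alpha\in\mathbb C$, and $D(\alpha)^\dagger$ is its adjoint. The formal sum $\sum_{m}(D(\alpha)|m\rangle_0)\otimes|m\rangle_1$ is the generalized vector (entire function, not of finite norm) $e^{-|\alpha|^2/2}e^{\bar u_0\bar u_1-\bar\alpha\bar u_1+\alpha\bar u_0}$. *)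

(* Defs.v *)
From HB Require Import structures.
From mathcomp Require Import all_boot all_order all_algebra.
From mathcomp Require Import all_classical all_reals all_analysis.
From mathcomp Require Import complex.

Set Implicit Arguments.
Unset Strict Implicit.
Unset Printing Implicit Defensive.

Import Order.TTheory GRing.Theory Num.Theory numFieldNormedType.Exports.

Import ComplexField.Normc.

Local Open Scope classical_set_scope.
Local Open Scope ring_scope.
Local Open Scope complex_scope.

(* The topology and the C-normed module structure of R[i], as for every
   other numeric field. *)
HB.instance Definition _ (R : realType) := GRing.ComAlgebra.copy R[i] R[i]^o.
HB.instance Definition _ (R : realType) := Vector.copy R[i] R[i]^o.
HB.instance Definition _ (R : realType) := NormedModule.copy R[i] R[i]^o.

Section Bargmann.
Context {R : realType}.
Local Notation C := R[i].

Definition tanhR (x : R) : R := (expR x - expR (- x)) / (expR x + expR (- x)).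

Definition cexp (z : C) : C :=
  (expR (complex.Re z) * cos (complex.Im z))
    +i* (expR (complex.Re z) * sin (complex.Im z)).

Local Notation leb2 := (@lebesgue_measure R \x @lebesgue_measure R)%E.

Definition integrableC (F : R * R -> C) : Prop :=
  leb2.-integrable setT (fun p => (complex.Re (F p))%:E) /\
  leb2.-integrable setT (fun p => (complex.Im (F p))%:E).

Definition integralC (F : R * R -> C) : C :=
  Rintegral leb2 setT (fun p => complex.Re (F p))
    +i* Rintegral leb2 setT (fun p => complex.Im (F p)).

(* Unspecified value when the series diverges. *)
Definition sumC (u : nat -> C) : C := limn (series u).

(* A vector of the Bargmann space is represented by the function w |-> f w of
   the variable w = conj u, so it is evaluated at conj u under integrals over
   u = x + i y.  The Gaussian measure exp (- conj u * u) dx dy / pi is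
   represented by its density. *)
Definition gauss (u : C) : R := expR (- normc u ^+ 2) / pi.

Definition entire (f : C -> C) : Prop := forall w : C, derivable f w 1.

Definition square_integrable (f : C -> C) : Prop :=
  leb2.-integrable setT (fun p => let u := p.1 +i* p.2 in
    (normc (f u^*%C) ^+ 2 * gauss u)%:E).

Definition bargmann (f : C -> C) : Prop := entire f /\ square_integrable f.

Definition inner (f h : C -> C) : C :=
  integralC (fun p => let u := p.1 +i* p.2 in
    (f u^*%C)^*%C * h u^*%C * (gauss u)%:C).

Definition ket (n : nat) (w : C) : C := w ^+ n / (Num.sqrt (n`!%:R : R))%:C.

Definition displacement (alpha : C) (f : C -> C) (w : C) : C :=
  (expR (- normc alpha ^+ 2 / 2))%:C * cexp (alpha * w) * f (w - alpha^*%C).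

(* The adjoint of an everywhere defined operator A of the Bargmann space:
   adjoint A f is the vector h with <k|h> = <A k|f> for every vector k
   (and the zero function if there is no such vector). *)
Definition adjoint (A : (C -> C) -> (C -> C)) (f : C -> C) : C -> C :=
  xget (cst 0) [set h | bargmann h /\
    forall k, bargmann k -> inner k h = inner (A k) f].

(* The values at (w0, w1) of the terms of the unnormalised generalized Bell
   vector sum_m (D(alpha)|m>_0) (x) |m>_1. *)
Definition bell_term (alpha w0 w1 : C) (m : nat) : C :=
  displacement alpha (ket m) w0 * ket m w1.

(* The values at (w1, w2) of the terms of sum_n q^n |n>_1 (x) |n>_2. *)
Definition squeezed_term (q w1 w2 : C) (n : nat) : C :=
  q ^+ n * ket n w1 * ket n w2.

(* The values at w2 of the terms of sum_n q^n <n|D(alpha)^dagger|psi> |n>_2. *)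
Definition output_term (q alpha : C) (psi : C -> C) (w2 : C) (n : nat) : C :=
  q ^+ n * inner (ket n) (adjoint (displacement alpha) psi) * ket n w2.

Definition Phi1 (q : C) (psi : C -> C) (w0 w1 w2 : C) : C :=
  (pi `^ (- 2^-1))%:C * (psi w0 * sumC (squeezed_term q w1 w2)).

End Bargmann.

(* Main.v *)
Require Import Defs.
From HB Require Import structures.
From mathcomp Require Import all_boot all_order all_algebra.
From mathcomp Require Import all_classical all_reals all_analysis.
From mathcomp Require Import measurable_realfun complex ring lra.

Set Implicit Arguments.
Unset Strict Implicit.
Unset Printing Implicit Defensive.

Import Order.TTheory GRing.Theory Num.Theory numFieldNormedType.Exports.

Import ComplexField.Normc.

Local Open Scope classical_set_scope.
Local Open Scope ring_scope.
Local Open Scope complex_scope.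

(* Since D(alpha)^dagger = D(-alpha), the sum over n is the Taylor expansion of
   D(-alpha) psi at q w2, and the integrand of the expansion is
     f(conj alpha) exp(c alpha - |alpha|^2), where c = w0 - q w2 and
     f z = exp(w0 w1 - w1 z) psi(z + q w2).
   The theorem is therefore an instance of the reproducing property
     int f(conj u) exp(c u - |u|^2) dx dy = pi f(c)
   of entire functions f for which |f(conj u)| exp(k |u| - |u|^2) is integrable for
   all k.  The same property identifies the adjoint, by testing against the
   coherent vectors z |-> exp(conj w z), and sums the Taylor expansion, by
   dominated convergence of the partial sums of exp(c u).
   A translation of u by conj c reduces the reproducing property to c = 0.  There
   it follows from the invariance of the Lebesgue measure under rotations and the
   mean value property on circles.  For the latter, Goursat's bisection shows that
   the integral of f(z exp w) over a vertical segment of length 2 pi of the w-plane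
   does not depend on its abscissa, which then tends to -oo. *)

(** The function f need not lie in the Bargmann space: multiplication by an exponential and
    translation of the argument, taken separately, do not preserve square integrability against the
    Gaussian, although their combination in a displacement does. The reproducing property is
    therefore proved on the larger class [gaussian_growth], which is stable under both operations
    and contains the Bargmann space. The substitution z exp w turns circles around 0 into vertical
    segments of a function with period 2 pi i. On a rectangle of height 2 pi the horizontal sides
    cancel, so Cauchy's theorem is needed for rectangles only. The sides enter through real
    primitives of the components of the integrand, so that the bisection compares increments of
    primitives and bounds them by the mean value theorem. Averaging over rotations by means of
    Fubini's theorem takes the place of polar coordinates. Up to that point only real parts are
    treated, since Im f is the real part of - i f. *)

(** * Derivatives without division, and moduli of complex numbers *)

(** Clearing the denominator of the difference quotient admits h = 0 and lets estimates be added.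
    The field is arbitrary because the criterion serves over both R and R[i]. *)
Lemma is_derive_epsP (K : numFieldType) (f : K -> K) (w l : K) :
  is_derive w 1 f l <-> forall e : K, 0 < e -> exists2 d : K, 0 < d &
    forall h, `|h| < d -> `|f (w + h) - f w - l * h| <= e * `|h|.
Proof.
split.
  move=> fw; have : h^-1 *: (f (h *: 1 + w) - f w) @[h --> (0 : K)^'] --> l.
    have [/[swap] <- +] := fw; exact.
  move/cvgrPdist_lt => H e e0.
  have := H e e0 => -[d /= d0 Hd]; exists d => // h hd.
  have [->|h0] := eqVneq h 0.
    by rewrite addr0 subrr mulr0 subr0 normr0 mulr0.
  have := Hd h; rewrite /ball_/= sub0r normrN => /(_ hd h0) /ltW H1.
  have -> : f (w + h) - f w - l * h =
      - (l - h^-1 *: (f (h *: 1 + w) - f w)) * h.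
    by rewrite opprB mulrBl /GRing.scale/= mulr1 (addrC h) (mulrC h^-1) divfK.
  by rewrite normrM normrN ler_wpM2r.
move=> H.
have lim : h^-1 *: (f (h *: 1 + w) - f w) @[h --> (0 : K)^'] --> l.
  apply/cvgrPdist_lt => e e0.
  have [|d d0 Hd] := H (e / 2); first by rewrite divr_gt0.
  exists d => //= h; rewrite /ball_/= sub0r normrN => hd h0.
  have -> : l - h^-1 *: (f (h *: 1 + w) - f w) =
      - (f (w + h) - f w - l * h) * h^-1.
    by rewrite opprB mulrBl mulfK// /GRing.scale/= mulr1 (addrC h) (mulrC h^-1).
  rewrite normrM normrN normfV ltr_pdivrMr ?normr_gt0//.
  apply: (le_lt_trans (Hd _ hd)); rewrite ltr_pM2r ?normr_gt0//.
  by rewrite ltr_pdivrMr// mulr_natr mulr2n ltrDl.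
by split; [exact: cvgP lim|exact: cvg_lim lim].
Qed.

Section ComplexBasics.
Context {R : realType}.
Local Notation C := R[i].
Implicit Types z w : C.

Lemma normc_normr z : `|z| = (normc z)%:C.
Proof. by rewrite normc_def; case: z. Qed.

Lemma normc_ge0 z : 0 <= normc z.
Proof. by rewrite -ler0c -normc_normr. Qed.

Lemma normc_sqr z : normc z ^+ 2 = complex.Re z ^+ 2 + complex.Im z ^+ 2.
Proof. by case: z => x y /=; rewrite sqr_sqrtr// addr_ge0// sqr_ge0. Qed.

Lemma ler_Re_normc z : `|complex.Re z| <= normc z.
Proof.
rewrite -(@ler_pXn2r _ 2)// ?nnegrE ?normc_ge0//.
by rewrite normc_sqr real_normK ?num_real// lerDl sqr_ge0.
Qed.

Lemma ler_Im_normc z : `|complex.Im z| <= normc z.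
Proof.
rewrite -(@ler_pXn2r _ 2)// ?nnegrE ?normc_ge0//.
by rewrite normc_sqr (real_normK (num_real _)) lerDr sqr_ge0.
Qed.

Lemma ler_normc_ReIm z : normc z <= `|complex.Re z| + `|complex.Im z|.
Proof.
rewrite -(@ler_pXn2r _ 2)// ?nnegrE ?normc_ge0// ?addr_ge0//.
rewrite normc_sqr sqrrD !real_normK ?num_real//.
by rewrite addrAC lerDl mulrn_wge0 ?mulr_ge0.
Qed.

Lemma normcR (x : R) : normc x%:C = `|x|.
Proof. by rewrite /= expr0n/= addr0 sqrtr_sqr. Qed.

Lemma normcJ z : normc z^*%C = normc z.
Proof. by case: z => x y /=; rewrite sqrrN. Qed.

Lemma normcX z n : normc (z ^+ n) = normc z ^+ n.
Proof.
elim: n => [|n IH]; first by rewrite !expr0 normc1.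
by rewrite !exprS normcM IH.
Qed.

Lemma normcB z w : normc (z - w) = normc (w - z).
Proof. by rewrite -normcN opprB. Qed.

Lemma cReD z w : complex.Re (z + w) = complex.Re z + complex.Re w.
Proof. by case: z; case: w. Qed.
Lemma cImD z w : complex.Im (z + w) = complex.Im z + complex.Im w.
Proof. by case: z; case: w. Qed.
Lemma cReN z : complex.Re (- z) = - complex.Re z.
Proof. by case: z. Qed.
Lemma cImN z : complex.Im (- z) = - complex.Im z.
Proof. by case: z. Qed.
Lemma cReM z w : complex.Re (z * w) =
  complex.Re z * complex.Re w - complex.Im z * complex.Im w.
Proof. by case: z; case: w. Qed.
Lemma cImM z w : complex.Im (z * w) =
  complex.Re z * complex.Im w + complex.Im z * complex.Re w.
Proof. by case: z; case: w. Qed.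

Lemma eqc z w : complex.Re z = complex.Re w -> complex.Im z = complex.Im w ->
  z = w.
Proof. by case: z => a b; case: w => c d /= -> ->. Qed.

Lemma normc_sum_le n (u : nat -> C) :
  normc (\sum_(0 <= k < n) u k) <= \sum_(0 <= k < n) normc (u k).
Proof.
elim: n => [|n IH]; first by rewrite !big_geq ?normc0.
by rewrite !big_nat_recr//=; apply: (le_trans (le_normcD _ _)); rewrite lerD2r.
Qed.

Lemma cvgC_normc (u : nat -> C) (l : C) :
  (fun n => normc (u n - l)) @ \oo --> (0 : R) -> u @ \oo --> l.
Proof.
move=> h; apply/cvgrPdist_lt => -[e e'] e0.
have e00 : (0 : R) < e by move: e0; rewrite ltcE/= => /andP[].
have e'0 : e' = 0 by move: e0; rewrite ltcE/= => /andP[/eqP].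
move/cvgrPdist_lt: h => /(_ _ e00); apply: filterS => n.
rewrite sub0r normrN ger0_norm ?normc_ge0// => h.
by rewrite e'0 normc_normr normcB ltcR.
Qed.

(** A positive element of R[i] is real, so e and d may be taken in R; all estimates then concern the
    real number [normc]. *)
Definition has_cderiv (f : C -> C) (w l : C) := forall e : R, 0 < e ->
  exists2 d : R, 0 < d & forall h, normc h < d ->
    normc (f (w + h) - f w - l * h) <= e * normc h.

Lemma has_cderivP (f : C -> C) (w l : C) :
  is_derive w 1 f l <-> has_cderiv f w l.
Proof.
split=> [/is_derive_epsP H e e0|H].
  have := H e%:C; rewrite ltcR => /(_ e0) [[d d']].
  rewrite ltcE/= => /andP[/eqP -> d0] Hd; exists d => // h hd.
  have := Hd h; rewrite !normc_normr -rmorphM/= !lecR; apply.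
  by rewrite (_ : d +i* 0 = d%:C)// ltcR.
apply/is_derive_epsP => -[e e'].
rewrite ltcE/= => /andP[/eqP-> e0]; have [d d0 Hd] := H e e0.
exists d%:C => [|h]; first by rewrite ltcR.
by rewrite !normc_normr (_ : e +i* 0 = e%:C)// -rmorphM/= ltcR lecR; exact: Hd.
Qed.

End ComplexBasics.

(** * The complex exponential and entire functions *)

Section ComplexExponential.
Context {R : realType}.
Local Notation C := R[i].
Implicit Types (z w : C) (f g : C -> C).

Lemma has_cderiv_cst (c w : C) : has_cderiv (cst c) w 0.
Proof.
move=> e e0; exists 1 => // h _.
by rewrite /cst subrr mul0r subr0 normc0 mulr_ge0 ?normc_ge0// ltW.
Qed.

Lemma has_cderiv_affine (a b w : C) : has_cderiv (fun z => a * z + b) w a.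
Proof.
move=> e e0; exists 1 => // h _.
rewrite (_ : _ - _ = 0); last by ring.
by rewrite normc0 mulr_ge0 ?normc_ge0// ltW.
Qed.

Lemma has_cderivM f g w l m : has_cderiv f w l -> has_cderiv g w m ->
  has_cderiv (fun z => f z * g z) w (l * g w + f w * m).
Proof.
move=> /has_cderivP fl /has_cderivP gm; apply/has_cderivP.
rewrite (_ : l * _ + _ = f w *: m + g w *: l); first exact: is_deriveM.
by rewrite /GRing.scale/= addrC (mulrC l).
Qed.

Lemma has_cderivD f g w l m : has_cderiv f w l -> has_cderiv g w m ->
  has_cderiv (fun z => f z + g z) w (l + m).
Proof.
by move=> /has_cderivP fl /has_cderivP gm; apply/has_cderivP; exact: is_deriveD.
Qed.

Lemma has_cderiv_lip f w l : has_cderiv f w l -> exists2 d : R, 0 < d &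
  forall h, normc h < d -> normc (f (w + h) - f w) <= (1 + normc l) * normc h.
Proof.
move=> /(_ 1 ltr01) [d d0 Hd]; exists d => // h /Hd H.
rewrite (_ : f (w + h) - f w = f (w + h) - f w - l * h + l * h); last by ring.
apply: (le_trans (le_normcD _ _)).
by rewrite normcM mulrDl lerD2r.
Qed.

Lemma has_cderiv_comp f g w l m : has_cderiv f (g w) l -> has_cderiv g w m ->
  has_cderiv (fun z => f (g z)) w (l * m).
Proof.
move=> Hf Hg e e0.
set M := 1 + normc m.
have M0 : 0 < M by rewrite ltr_wpDr ?normc_ge0.
have L0 : 0 < 1 + normc l by rewrite ltr_wpDr ?normc_ge0.
have [|d1 d10 H1] := Hf (e / 2 / M); first by rewrite !divr_gt0.
have [|d2 d20 H2] := Hg (e / 2 / (1 + normc l)); first by rewrite !divr_gt0.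
have [d3 d30 H3] := has_cderiv_lip Hg.
exists (Num.min d2 (Num.min d3 (d1 / M))) => [|h].
  by rewrite !lt_min d20 d30 divr_gt0.
rewrite !lt_min => /and3P[h2 h3 h1].
set k := g (w + h) - g w.
have kh : normc k <= M * normc h by exact: H3.
have := H1 k; rewrite (_ : g w + k = g (w + h)); last by rewrite /k; ring.
have k1 : normc k < d1.
  by apply: (le_lt_trans kh); rewrite mulrC -ltr_pdivlMr.
move=> /(_ k1) K1; have K2 := H2 h h2.
(* The error of f at the increment k of g, plus l times the error of g; each is bounded by half of e
   |h|. *)
rewrite (_ : _ - l * m * h =
  (f (g (w + h)) - f (g w) - l * k) + l * (k - m * h)); last by ring.
apply: (le_trans (le_normcD _ _)); rewrite normcM.
have -> : e * normc h = e / 2 / M * (M * normc h) +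
   (1 + normc l) * (e / 2 / (1 + normc l) * normc h).
  by field; rewrite !gt_eqF.
apply: lerD; first by apply: (le_trans K1); rewrite ler_pM2l// !divr_gt0.
apply: ler_pM => //; rewrite ?normc_ge0//.
by rewrite lerDr.
Qed.

Lemma cexp0 : cexp (0 : C) = 1.
Proof. by rewrite /cexp/= expR0 cos0 sin0 mulr1 mulr0. Qed.

Lemma cexpD z w : cexp (z + w) = cexp z * cexp w.
Proof.
by apply: eqc; rewrite ?cReM ?cImM /= cReD cImD expRD ?cosD ?sinD; ring.
Qed.

Lemma cexpNK z : cexp z * cexp (- z) = 1.
Proof. by rewrite -cexpD subrr cexp0. Qed.

Lemma normc_cexp z : normc (cexp z) = expR (complex.Re z).
Proof.
by rewrite /cexp /normc !exprMn -mulrDr cos2Dsin2 mulr1 sqrtr_sqr ger0_norm// expR_ge0.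
Qed.

Lemma normc_cexp_le z : normc (cexp z) <= expR (normc z).
Proof.
by rewrite normc_cexp ler_expR (le_trans (ler_norm _))// ler_Re_normc.
Qed.

Lemma cexpJ z : cexp z^*%C = (cexp z)^*%C.
Proof. by case: z => x y; apply: eqc; rewrite /= ?cosN// sinN mulrN. Qed.

Lemma cexpR (x : R) : cexp x%:C = (expR x)%:C.
Proof. by apply: eqc; rewrite /= ?cos0 ?sin0 ?mulr1 ?mulr0. Qed.

(** Reduces to the derivatives at 0 of the real functions exp, sin and cos. With tolerance n for
    each of them, the real and the imaginary part of the error are at most 3 n |h| each, whence n <=
    e / 6. The bounds n <= 1 and |h| < n / 2 give |exp x - 1| <= n and exp x <= 2. *)
Lemma has_cderiv_cexp0 : has_cderiv (@cexp R) 0 1.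
Proof.
move=> e e0.
set n := Num.min (e / 6) 1.
have n0 : 0 < n by rewrite lt_min ltr01 andbT divr_gt0.
have n1 : n <= 1 by rewrite ge_min lexx orbT.
have n6 : 6 * n <= e by rewrite mulrC -ler_pdivlMr// ge_min lexx.
have [d1 d10 H1] := (is_derive_epsP _ _ _).1 (is_derive_expR (0 : R)) n n0.
have [d2 d20 H2] := (is_derive_epsP _ _ _).1 (is_derive_sin (0 : R)) n n0.
have [d3 d30 H3] := (is_derive_epsP _ _ _).1 (is_derive_cos (0 : R)) n n0.
exists (Num.min d1 (Num.min d2 (Num.min d3 (n / 2)))) => [|h].
  by rewrite !lt_min d10 d20 d30 divr_gt0.
rewrite !lt_min => /and4P[h1 h2 h3 h4].
rewrite add0r cexp0 mul1r; apply: (le_trans (ler_normc_ReIm _)).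
have := ler_Re_normc h; have := ler_Im_normc h.
case: h h1 h2 h3 h4 => x y; set N := normc _ => h1 h2 h3 h4 /= yN xN.
move: (H1 x (le_lt_trans xN h1)) (H2 y (le_lt_trans yN h2)) (H3 y (le_lt_trans yN h3)).
rewrite !add0r ?addr0 expR0 sin0 cos0 oppr0 mul0r subr0 !mul1r ?subr0 ?addr0.
move=> {H1 H2 H3}E1 E2 E3.
have N0 : 0 <= N by exact: normc_ge0.
have nN : n * N >= 0 by rewrite mulr_ge0// ltW.
have X : `|expR x - 1| <= n.
  rewrite (_ : expR x - 1 = expR x - 1 - x + x); last by ring.
  apply: (le_trans (ler_normD _ _)); apply: (@le_trans _ _ (n * `|x| + `|x|)).
    by rewrite lerD2r.
  have : n * `|x| <= 1 * `|x| by rewrite ler_wpM2r.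
  by lra.
have X2 : `|expR x| <= 2.
  rewrite (_ : expR x = expR x - 1 + 1); last by ring.
  by apply: (le_trans (ler_normD _ _)); rewrite normr1; lra.
have A1 : n * `|x| <= n * N by rewrite ler_pM2l.
have A2 : n * `|y| <= n * N by rewrite ler_pM2l.
have T1 : `|expR x * cos y - 1 - x| <= 3 * (n * N).
  rewrite (_ : _ - x = expR x * (cos y - 1) + (expR x - 1 - x)); last by ring.
  apply: (le_trans (ler_normD _ _)); rewrite normrM.
  have : `|expR x| * `|cos y - 1| <= 2 * (n * `|y|) by exact: ler_pM.
  by lra.
have T2 : `|expR x * sin y - y| <= 3 * (n * N).
  rewrite (_ : _ - y = expR x * (sin y - y) + (expR x - 1) * y); last by ring.
  apply: (le_trans (ler_normD _ _)); rewrite !normrM.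
  have : `|expR x| * `|sin y - y| <= 2 * (n * `|y|) by exact: ler_pM.
  have : `|expR x - 1| * `|y| <= n * `|y| by rewrite ler_wpM2r.
  by lra.
have : 6 * n * N <= e * N by rewrite ler_wpM2r.
by lra.
Qed.

Lemma has_cderiv_cexp w : has_cderiv (@cexp R) w (cexp w).
Proof.
move=> e e0.
have W0 : 0 < normc (cexp w) by rewrite normc_cexp expR_gt0.
have [|d d0 Hd] := has_cderiv_cexp0 (e := e / normc (cexp w)); first by rewrite divr_gt0.
exists d => // h /Hd; rewrite add0r cexp0 mul1r => H.
rewrite cexpD (_ : _ - cexp w * h = cexp w * (cexp h - 1 - h)); last by ring.
by rewrite normcM mulrC -ler_pdivlMr// mulrAC.
Qed.

Lemma entireP f : entire f <-> forall w, exists l, has_cderiv f w l.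
Proof.
split=> [H w|H w]; first by exists ('D_1 f w); apply/has_cderivP; exact: derivableP.
by have [l /has_cderivP []] := H w.
Qed.

Lemma entireM f g : entire f -> entire g -> entire (fun z => f z * g z).
Proof.
move=> /entireP Hf /entireP Hg; apply/entireP => w.
have [l Hl] := Hf w; have [m Hm] := Hg w.
by eexists; exact: has_cderivM Hl Hm.
Qed.

Lemma entireZ c f : entire f -> entire (fun z => c * f z).
Proof.
move=> /entireP Hf; apply/entireP => w; have [l Hl] := Hf w.
by eexists; exact: (has_cderivM (has_cderiv_cst c w) Hl).
Qed.

Lemma entire_comp f g : entire f -> entire g -> entire (fun z => f (g z)).
Proof.
move=> /entireP Hf /entireP Hg; apply/entireP => w.
have [m Hm] := Hg w; have [l Hl] := Hf (g w).
by eexists; exact: has_cderiv_comp Hl Hm.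
Qed.

Lemma entire_affine (a b : C) : entire (fun z => a * z + b).
Proof. by apply/entireP => w; exists a; exact: has_cderiv_affine. Qed.

Lemma entire_cexp : entire (@cexp R).
Proof. by apply/entireP => w; exists (cexp w); exact: has_cderiv_cexp. Qed.

(** Passage to real calculus: along a real line the components become real functions, to which the
    mean value theorem and the fundamental theorem apply. *)
Lemma has_cderiv_line f (a b : C) (t : R) (l : C) :
  has_cderiv f (a + t%:C * b) l ->
  is_derive t 1 (fun t : R => complex.Re (f (a + t%:C * b))) (complex.Re (l * b)) /\
  is_derive t 1 (fun t : R => complex.Im (f (a + t%:C * b))) (complex.Im (l * b)).
Proof.
move=> H.
have B0 : 0 < 1 + normc b by rewrite ltr_wpDr ?normc_ge0.
have K : forall e : R, 0 < e -> exists2 d : R, 0 < d & forall h : R, `|h| < d ->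
    normc (f (a + (t + h)%:C * b) - f (a + t%:C * b) - l * b * h%:C) <= e * `|h|.
  move=> e e0; have [|d d0 Hd] := H (e / (1 + normc b)); first by rewrite divr_gt0.
  exists (d / (1 + normc b)); first by rewrite divr_gt0.
  move=> h; rewrite ltr_pdivlMr// => hd.
  have := Hd (h%:C * b); rewrite normcM normcR.
  have hb : `|h| * normc b <= `|h| * (1 + normc b) by rewrite ler_wpM2l// lerDr.
  move=> /(_ (le_lt_trans hb hd)).
  rewrite rmorphD/= mulrDl addrA -!mulrA (mulrC b) => /le_trans; apply.
  have -> : e * `|h| = e / (1 + normc b) * (`|h| * (1 + normc b)).
    by field; rewrite gt_eqF.
  by rewrite mulrA ler_pM2l// divr_gt0.
split; apply/is_derive_epsP => e e0; have [d d0 Hd] := K e e0; exists d => // h /Hd.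
- move/(le_trans (ler_Re_normc _)); rewrite !cReD !cReN. rewrite (cReM (l * b)) /= mulr0 subr0.
  by [].
- move/(le_trans (ler_Im_normc _)); rewrite !cImD !cImN (cImM (l * b)) /= mulr0 add0r.
  by [].
Qed.

End ComplexExponential.

(** * Goursat's theorem for rectangles *)

Section Goursat.
Context {R : realType}.
Local Notation C := R[i].

Lemma nested_intervals (a b : nat -> R) :
  (forall n, a n <= a n.+1) -> (forall n, b n.+1 <= b n) ->
  (forall n, a n <= b n) -> exists x, forall n, a n <= x <= b n.
Proof.
move=> ha hb ab.
have am : {homo a : m n / (m <= n)%N >-> m <= n} by apply/nondecreasing_seqP.
have bm : {homo b : m n / (m <= n)%N >-> n <= m} by apply/nonincreasing_seqP.
have amb m n : a m <= b n.
  apply: (@le_trans _ _ (a (maxn m n))); first by apply: am; rewrite leq_maxl.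
  by apply: (le_trans (ab _)); apply: bm; rewrite leq_maxr.
have ub n : ubound (range a) (b n) by move=> _ [m _ <-].
exists (sup (range a)) => n; apply/andP; split.
  by apply: ub_le_sup; [exists (b 0%N); exact: ub|exists n].
by apply: ge_sup; [exists (a 0%N), 0%N|exact: ub].
Qed.

(** Mean value theorem for F minus the quadratic polynomial with derivative p + q x. It replaces the
    bound of an integral by the supremum of the integrand; the affine comparison is what complex
    differentiability provides along a side of a rectangle. *)
Lemma increment_approx (F F' : R -> R) (a b p q e : R) : a <= b ->
  (forall x, x \in `[a, b] -> is_derive x 1 F (F' x)) ->
  (forall x, x \in `[a, b] -> `|F' x - (p + q * x)| <= e) ->
  `|F b - F a - (p * (b - a) + q * (b ^+ 2 - a ^+ 2) / 2)| <= e * (b - a).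
Proof.
move=> ab HF He.
pose G x := F x - (p * x + q / 2 * x ^+ 2).
have HG x : x \in `[a, b] -> is_derive x 1 G (F' x - (p + q * x)).
  move=> xab; rewrite /G; have hF := HF x xab.
  apply: is_derive_eq.
  by rewrite /GRing.scale/= !mulr1; field.
have cG : {within `[a, b], continuous G}.
  by apply: derivable_within_continuous => x xab; have [] := HG x xab.
have HG' x : x \in `]a, b[ -> is_derive x 1 G (F' x - (p + q * x)).
  by move=> xab; apply: HG; exact: subset_itv_oo_cc.
have [c cab Gc] := MVT_segment ab HG' cG.
rewrite (_ : _ - _ = G b - G a); last by rewrite /G; field.
rewrite Gc normrM (ger0_norm (_ : 0 <= b - a)) ?subr_ge0//.
by rewrite ler_wpM2r ?subr_ge0// He.
Qed.

(* The imaginary part of the integral of f along the boundary of a rectangle,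
   written through primitives A y of x |-> Im f and B x of y |-> Re f. *)
Definition boundary_increment (A B : R -> R -> R) (a b c d : R) : R :=
  (A c b - A c a) - (A d b - A d a) + (B b d - B b c) - (B a d - B a c).

(** On a small rectangle around a point of differentiability, f is affine up to (e / 2) s, where s
    is the half perimeter. The affine part contributes nothing to a closed boundary, and the error
    over a perimeter of length 2 s is at most e s ^ 2. *)
Lemma boundary_increment_local (f : C -> C) (K : R) (A B : R -> R -> R) (x y e : R) :
  (exists l, has_cderiv f (x +i* y) l) ->
  (forall v u, u \in `]- K, K[ -> is_derive u 1 (A v) (complex.Im (f (u +i* v)))) ->
  (forall u v, v \in `]- K, K[ -> is_derive v 1 (B u) (complex.Re (f (u +i* v)))) ->
  0 < e ->
  exists2 r : R, 0 < r & forall a b c d, - K < a -> b < K -> - K < c -> d < K ->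
    a <= x <= b -> c <= y <= d -> b - a + (d - c) < r ->
    `|boundary_increment A B a b c d| <= e * (b - a + (d - c)) ^+ 2.
Proof.
move=> [l Hl] HA HB e0.
have [|r r0 Hr] := Hl (e / 2); first by rewrite divr_gt0.
exists r => // a b c d Ka bK Kc dK /andP[ax xb] /andP[cy yd] S.
set s := b - a + (d - c).
have ab : a <= b by exact: le_trans xb.
have cd : c <= d by exact: le_trans yd.
have near u v : u \in `[a, b] -> v \in `[c, d] ->
   normc (f (u +i* v) - f (x +i* y) - l * ((u - x) +i* (v - y))) <= e / 2 * s.
  rewrite !in_itv/= => /andP[au ub] /andP[cv vd].
  have hs : normc ((u - x) +i* (v - y)) <= s.
    apply: (le_trans (ler_normc_ReIm _)); rewrite /= /s.
    have : `|u - x| <= b - a by rewrite ler_norml; apply/andP; split; lra.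
    have : `|v - y| <= d - c by rewrite ler_norml; apply/andP; split; lra.
    by lra.
  have := Hr ((u - x) +i* (v - y)) (le_lt_trans hs S).
  rewrite (_ : x +i* y + ((u - x) +i* (v - y)) = u +i* v); last first.
    by apply: eqc => /=; ring.
  by move=> /le_trans; apply; rewrite ler_pM2l// divr_gt0.
set f1 := complex.Re (f (x +i* y)); set f2 := complex.Im (f (x +i* y)).
set l1 := complex.Re l; set l2 := complex.Im l.
have nA v : v \in `[c, d] ->
    `|A v b - A v a - ((f2 + l1 * (v - y) - l2 * x) * (b - a) +
       l2 * (b ^+ 2 - a ^+ 2) / 2)| <= e / 2 * s * (b - a).
  move=> vcd.
  have H1 u : u \in `[a, b] -> is_derive u 1 (A v) (complex.Im (f (u +i* v))).
    rewrite in_itv/= => /andP[au ub]; apply: HA.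
    by rewrite in_itv/= (lt_le_trans Ka au) (le_lt_trans ub bK).
  have H2 u : u \in `[a, b] ->
      `|complex.Im (f (u +i* v)) - (f2 + l1 * (v - y) - l2 * x + l2 * u)| <= e / 2 * s.
    move=> uab; have /(le_trans (ler_Im_normc _)) := near u v uab vcd.
    rewrite !cImD !cImN cImM /= -/f2 -/l1 -/l2 => H; apply: le_trans H.
    by rewrite le_eqVlt; apply/orP; left; apply/eqP; congr (`|_|); ring.
  exact: (increment_approx ab H1 H2).
have nB u : u \in `[a, b] ->
    `|B u d - B u c - ((f1 + l1 * (u - x) + l2 * y) * (d - c) +
       - l2 * (d ^+ 2 - c ^+ 2) / 2)| <= e / 2 * s * (d - c).
  move=> uab.
  have H1 v : v \in `[c, d] -> is_derive v 1 (B u) (complex.Re (f (u +i* v))).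
    rewrite in_itv/= => /andP[cv vd]; apply: HB.
    by rewrite in_itv/= (lt_le_trans Kc cv) (le_lt_trans vd dK).
  have H2 v : v \in `[c, d] ->
      `|complex.Re (f (u +i* v)) - (f1 + l1 * (u - x) + l2 * y + - l2 * v)| <= e / 2 * s.
    move=> vcd; have /(le_trans (ler_Re_normc _)) := near u v uab vcd.
    rewrite !cReD !cReN cReM /= -/f1 -/l1 -/l2 => H; apply: le_trans H.
    by rewrite le_eqVlt; apply/orP; left; apply/eqP; congr (`|_|); ring.
  exact: (increment_approx cd H1 H2).
have aab : a \in `[a, b] by rewrite in_itv/= lexx.
have bab : b \in `[a, b] by rewrite in_itv/= lexx andbT.
have ccd : c \in `[c, d] by rewrite in_itv/= lexx.
have dcd : d \in `[c, d] by rewrite in_itv/= lexx andbT.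
move: (nA c ccd) (nA d dcd) (nB a aab) (nB b bab).
rewrite /boundary_increment; set Ac := _ - A c a; set Ad := _ - A d a.
set Ba := _ - B a c; set Bb := _ - B b c.
set P := (_ + l2 * _ / 2); set Q := (_ + l2 * _ / 2).
set U := (_ + - l2 * _ / 2); set V := (_ + - l2 * _ / 2).
(* The affine approximation has boundary increment exactly 0. *)
have PQ : P - Q + V - U = 0 by rewrite /P /Q /U /V; field.
rewrite !ler_norml => /andP[h1 h2] /andP[h3 h4] /andP[h5 h6] /andP[h7 h8].
have -> : e * s ^+ 2 = e / 2 * s * (b - a) + e / 2 * s * (b - a)
  + e / 2 * s * (d - c) + e / 2 * s * (d - c) by rewrite /s; field.
by apply/andP; split; lra.
Qed.

(* Bisection: a rectangle whose increment exceeds e times the square of its half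
   perimeter has a quadrant with the same property, and such nested quadrants
   contradict the local estimate at their common point. *)
Lemma boundary_increment0 (f : C -> C) (K : R) (A B : R -> R -> R) (a b c d : R) :
  entire f ->
  (forall v u, u \in `]- K, K[ -> is_derive u 1 (A v) (complex.Im (f (u +i* v)))) ->
  (forall u v, v \in `]- K, K[ -> is_derive v 1 (B u) (complex.Re (f (u +i* v)))) ->
  - K < a -> a <= b -> b < K -> - K < c -> c <= d -> d < K ->
  boundary_increment A B a b c d = 0.
Proof.
move=> /entireP ef HA HB Ka ab bK Kc cd dK.
apply/eqP/negPn/negP => D0.
pose sz (r : R * R * R * R) := r.1.1.2 - r.1.1.1 + (r.2 - r.1.2).
pose D (r : R * R * R * R) := boundary_increment A B r.1.1.1 r.1.1.2 r.1.2 r.2.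
pose r0 := (a, b, c, d).
have S0 : 0 < sz r0.
  rewrite lt_neqAle /sz /= addr_ge0 ?subr_ge0// andbT.
  apply: contra D0 => /eqP h; have ab' : a = b by lra.
  have cd' : c = d by lra.
  by apply/eqP; rewrite /boundary_increment ab' cd'; ring.
(* Half of the initial ratio, so that r0 is bad with a strict inequality. *)
pose e := `|D r0| / sz r0 ^+ 2 / 2.
have e0 : 0 < e by rewrite !divr_gt0// ?exprn_gt0// normr_gt0.
pose bad (r : R * R * R * R) := e * sz r ^+ 2 < `|D r|.
pose sub (r r' : R * R * R * R) := [/\
  r.1.1.1 <= r'.1.1.1, r'.1.1.1 <= r'.1.1.2, r'.1.1.2 <= r.1.1.2 &
  r.1.2 <= r'.1.2] /\ [/\ r'.1.2 <= r'.2, r'.2 <= r.2 & sz r' = sz r / 2].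
have step r : r.1.1.1 <= r.1.1.2 -> r.1.2 <= r.2 -> bad r ->
    exists r', sub r r' /\ bad r'.
  case: r => [[[a1 b1] c1] d1] /= ab1 cd1 badr.
  set m := (a1 + b1) / 2; set n := (c1 + d1) / 2.
  (* If no quadrant were bad, each would contribute at most e sz ^ 2 / 4; the inner sides cancel in
     the sum of the four, which would contradict [badr]. *)
  apply: contrapT => /forallNP nex.
  have good r' : sub (a1, b1, c1, d1) r' -> `|D r'| <= e * sz (a1, b1, c1, d1) ^+ 2 / 4.
    move=> sr; have := nex r'; rewrite leNgt => H; apply/negP => H1; apply: H.
    split => //; apply: le_lt_trans H1.
    by case: sr => _ [_ _ ->]; rewrite le_eqVlt; apply/orP; left; apply/eqP; field.
  have DE : D (a1, b1, c1, d1) = D (a1, m, c1, n) + D (m, b1, c1, n) +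
      D (a1, m, n, d1) + D (m, b1, n, d1).
    by rewrite /D /boundary_increment /=; ring.
  move: badr; rewrite /bad ltNge DE => /negP; apply.
  have sb : forall r', r' \in [:: (a1, m, c1, n); (m, b1, c1, n);
     (a1, m, n, d1); (m, b1, n, d1)] -> sub (a1, b1, c1, d1) r'.
    clear - ab1 cd1; move=> r'; rewrite !inE => /or4P[] /eqP ->; rewrite /sub /sz /m /n /=;
    by split; split; lra.
  have /ler_normlP[g1 g1'] := good _ (sb (a1, m, c1, n) ltac:(by rewrite !inE eqxx)).
  have /ler_normlP[g2 g2'] := good _ (sb (m, b1, c1, n) ltac:(by rewrite !inE eqxx !orbT)).
  have /ler_normlP[g3 g3'] := good _ (sb (a1, m, n, d1) ltac:(by rewrite !inE eqxx !orbT)).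
  have /ler_normlP[g4 g4'] := good _ (sb (m, b1, n, d1) ltac:(by rewrite !inE eqxx !orbT)).
  by clear - g1 g1' g2 g2' g3 g3' g4 g4'; apply/ler_normlP; split; lra.
pose good (r : R * R * R * R) := [/\ r.1.1.1 <= r.1.1.2, r.1.2 <= r.2 & bad r].
have /choice[nx Hnx] : forall r, exists r', good r -> sub r r' /\ good r'.
  move=> r; have [[h1 h2 h3]|] := pselect (good r); last by exists r.
  have [r' [sr br]] := step r h1 h2 h3; exists r' => _; split=> //.
  by case: sr => -[_ k1 _ _] [k2 _ _].
pose u n := iter n nx r0.
have gu n : good (u n).
  elim: n => [|n IH]; last exact: (Hnx _ IH).2.
  split => //; rewrite /bad /e -[X in _ * X](mulr1) .
  rewrite mulrAC mulr1 divfK ?expf_neq0 ?gt_eqF//.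
  by rewrite ltr_pdivrMr// mulr_natr mulr2n ltrDl normr_gt0.
have su n : sub (u n) (u n.+1) by exact: (Hnx _ (gu n)).1.
have szu n : sz (u n) = sz r0 / 2 ^+ n.
  elim: n => [|n IH]; first by rewrite expr0 divr1.
  by have [_ [_ _ ->]] := su n; rewrite IH exprS invfM mulrA mulrAC.
have [x hx] : exists x, forall n, (u n).1.1.1 <= x <= (u n).1.1.2.
  apply: nested_intervals => n; [by case: (su n) => -[]..|by case: (gu n)].
have [y hy] : exists y, forall n, (u n).1.2 <= y <= (u n).2.
  by apply: nested_intervals => n;
    [by case: (su n) => -[]|by case: (su n) => _ []|by case: (gu n)].
have inK n : [/\ a <= (u n).1.1.1, (u n).1.1.2 <= b, c <= (u n).1.2 & (u n).2 <= d].
  elim: n => [|n [h1 h2 h3 h4]]; first by rewrite /u/= !lexx.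
  have [[k1 _ k2 k3] [_ k4 _]] := su n.
  by split; [exact: le_trans k1|exact: le_trans h2|exact: le_trans k3|exact: le_trans h4].
have [r rgt0 Hr] := boundary_increment_local (ef _) HA HB e0 (x := x) (y := y).
have [n szn] : exists n, sz (u n) < r.
  (* Uses n < 2 ^ n for an integer n exceeding sz r0 / r. *)
  exists (Num.truncn (sz r0 / r)).+1; rewrite szu ltr_pdivrMr ?exprn_gt0//.
  rewrite mulrC -ltr_pdivrMr//; apply: (lt_le_trans (truncnS_gt _)).
  by rewrite -natrX ler_nat ltnW// ltn_expl.
have [h1 h2 h3 h4] := inK n; have [_ _ ] := gu n; rewrite /bad ltNge => /negP; apply.
apply: Hr => //; [exact: lt_le_trans h1|exact: le_lt_trans bK|
  exact: lt_le_trans h3|exact: le_lt_trans dK].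
Qed.

(** The primitive is the integral from - K, hence the restriction to a bounded interval, which
    recurs in the hypotheses on A and B. *)
Lemma primitive_exists (f : R -> R) (K : R) : continuous f ->
  exists F : R -> R, forall x, x \in `]- K, K[ -> is_derive x 1 F (f x).
Proof.
move=> cf; exists (fun x => (\int[@lebesgue_measure R]_(t in `[- K, x]) f t)%R) => x.
rewrite in_itv/= => /andP[Kx xK].
have fi : (@lebesgue_measure R).-integrable `[- K, K] (EFin \o f).
  apply: continuous_compact_integrable; first exact: segment_compact.
  exact: continuous_subspaceT.
have [dF F'] := continuous_FTC1_closed xK fi Kx (cf x).
by split; [exact: dF|rewrite -derive1E].
Qed.

End Goursat.

(** * The mean value property on circles *)

Section CircleMean.
Context {R : realType}.
Local Notation C := R[i].
Implicit Types f : C -> C.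

Lemma continuous_entire_line f (a b : C) : entire f ->
  continuous (fun t : R => complex.Re (f (a + t%:C * b))) /\
  continuous (fun t : R => complex.Im (f (a + t%:C * b))).
Proof.
move=> /entireP ef; split => t; have [l Hl] := ef (a + t%:C * b);
  have [[H1 _] [H2 _]] := has_cderiv_line Hl; apply: differentiable_continuous;
  exact/derivable1_diffP.
Qed.

(** Primitives are selected by one choice function depending on the integrand alone, so lines with
    equal values of f receive the same primitive. This gives the last clause, by which the
    horizontal sides of a period rectangle cancel. *)
Lemma primitives_of_entire f (K : R) : entire f -> exists A B : R -> R -> R,
  [/\ forall v u, u \in `]- K, K[ -> is_derive u 1 (A v) (complex.Im (f (u +i* v))),
      forall u v, v \in `]- K, K[ -> is_derive v 1 (B u) (complex.Re (f (u +i* v))) &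
      forall v v', (forall u, f (u +i* v) = f (u +i* v')) -> A v = A v'].
Proof.
move=> ef.
have /choice[prim Hp] : forall g : R -> R, exists F : R -> R, continuous g ->
    forall x, x \in `]- K, K[ -> is_derive x 1 F (g x).
  move=> g; have [cg|] := pselect (continuous g); last by exists g.
  by have [F HF] := primitive_exists K cg; exists F.
have vE (u v : R) : u%:C + v%:C * 'i = u +i* v.
  by apply: eqc => /=; ring.
have uE (u v : R) : 0 +i* v + u%:C * 1 = u +i* v.
  by apply: eqc => /=; ring.
exists (fun v => prim (fun u => complex.Im (f (u +i* v)))).
exists (fun u => prim (fun v => complex.Re (f (u +i* v)))).
split.
- move=> v u; apply: Hp; rewrite (_ : (fun u => _) = fun u => complex.Im (f (0 +i* v + u%:C * 1))).
    exact: (continuous_entire_line _ _ ef).2.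
  by apply/funext => u'; rewrite uE.
- move=> u v; apply: Hp; rewrite (_ : (fun v => _) = fun v => complex.Re (f (u%:C + v%:C * 'i))).
    exact: (continuous_entire_line _ _ ef).1.
  by apply/funext => v'; rewrite vE.
- by move=> v v' h; congr prim; apply/funext => u; rewrite h.
Qed.

Lemma circle_mean f (z : C) : entire f ->
  (\int[@lebesgue_measure R]_(t in `[0%R, (2 * pi)%R])
     (complex.Re (f (z * (cos t +i* sin t))))%:E = (2 * pi * complex.Re (f 0))%:E)%E.
Proof.
move=> ef.
have pi0 : 0 < pi :> R by exact: pi_gt0.
pose h w := f (z * cexp w).
have eh : entire h.
  have e1 := @entireZ R z _ (@entire_cexp R).
  exact: (entire_comp ef e1).
have h0 (t : R) : h (0 +i* t) = f (z * (cos t +i* sin t)).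
  by rewrite /h /cexp /= expR0 !mul1r.
have periodic (s t : R) : h (s +i* (t + 2 * pi)) = h (s +i* t).
  by rewrite /h /cexp/= (mulrC 2) mulr_natr cosD2pi sinD2pi.
have ch : continuous (fun t => complex.Re (h (0 +i* t))).
  rewrite (_ : (fun t => _) = fun t => complex.Re (h (0 + t%:C * 'i))).
    exact: (continuous_entire_line _ _ eh).1.
  apply/funext => t; congr (complex.Re (h _)).
  by apply: eqc => /=; ring.
under eq_integral do rewrite -h0.
(* The integral is the increment of any primitive of the integrand. It is therefore enough to find,
   for each e, some primitive whose increment is close to the expected value; it may change with
   e. *)
suff small e : 0 < e -> exists2 F : R -> R, (forall x, x \in `[0, 2 * pi] ->
      is_derive x 1 F (complex.Re (h (0 +i* x)))) &
      `|F (2 * pi) - F 0 - 2 * pi * complex.Re (f 0)| <= e * (2 * pi).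
  have val F : (forall x, x \in `[0, 2 * pi] ->
      is_derive x 1 F (complex.Re (h (0 +i* x)))) ->
      (\int[@lebesgue_measure R]_(t in `[0%R, (2 * pi)%R]) (complex.Re (h (0 +i* t)))%:E
        = (F (2 * pi) - F 0)%:E)%E.
    move=> HF; rewrite (@continuous_FTC2 _ _ F) ?mulr_gt0//.
    - exact: continuous_subspaceT.
    - have cF x : x \in `[0, 2 * pi] -> {for x, continuous F}.
        move=> /HF[dF _]; apply: differentiable_continuous.
        exact/derivable1_diffP.
      split=> [x xab||].
      + by have [] := HF x (subset_itv_oo_cc xab).
      + by apply/cvg_at_right_filter/cF; rewrite in_itv/= lexx mulr_ge0// ltW.
      + by apply/cvg_at_left_filter/cF; rewrite in_itv/= lexx mulr_ge0// ltW.
    - move=> x xab; rewrite derive1E; have [] := HF x _; last by [].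
      exact: subset_itv_oo_cc.
  have [F0 dF0 _] := small 1 ltr01; rewrite (val _ dF0); congr EFin.
  apply/eqP; rewrite -subr_eq0 -normr_le0; apply/ler_addgt0Pl => e e0.
  have [|F dF leF] := small (e / (2 * pi)); first by rewrite divr_gt0// mulr_gt0.
  have [->] : (F0 (2 * pi) - F0 0)%:E = (F (2 * pi) - F 0)%:E by rewrite -(val _ dF0) -(val _ dF).
  by rewrite addr0; move: leF; rewrite divfK// gt_eqF// mulr_gt0.
move=> e0.
have [l Hl] := (entireP _).1 ef 0.
have [d d0 Hd] := has_cderiv_lip Hl.
pose M := (1 + normc l) * (1 + normc z).
have M0 : 0 < M by rewrite mulr_gt0// ltr_wpDr ?normc_ge0.
(* For exp s <= r, the first bound keeps z exp w within the radius d of the Lipschitz estimate at 0,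
   and the second makes the deviation from f 0 at most e. *)
pose r := Num.min (d / (1 + normc z)) (e / M).
have r0 : 0 < r by rewrite lt_min !divr_gt0// ltr_wpDr ?normc_ge0.
(* The abscissa of the far side; the value -1 ensures s <= 0, so that the rectangle lies between s
   and 0. *)
pose s := Num.min (ln r) (-1).
have s0 : s <= 0 by rewrite ge_min; apply/orP; right; lra.
have sr : expR s <= r.
  by rewrite -[leRHS]lnK ?posrE// ler_expR ge_min lexx.
have near (t : R) : `|complex.Re (h (s +i* t)) - complex.Re (f 0)| <= e.
  rewrite -cReN -cReD; apply: (le_trans (ler_Re_normc _)).
  have nz : normc (z * cexp (s +i* t)) = normc z * expR s by rewrite normcM normc_cexp.
  have hz : normc z * expR s <= normc z * r by rewrite ler_wpM2l ?normc_ge0.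
  have hz' : normc z * r < (1 + normc z) * r by rewrite ltr_pM2r// ltrDr.
  have := Hd (z * cexp (s +i* t)); rewrite add0r nz => H.
  apply: (le_trans (H _)).
    apply: (le_lt_trans hz); apply: (lt_le_trans hz').
    by rewrite mulrC -ler_pdivlMr ?ltr_wpDr ?normc_ge0// ge_min lexx.
  apply: (@le_trans _ _ (M * r)); last first.
    by rewrite mulrC -ler_pdivlMr// ge_min lexx orbT.
  rewrite /M -mulrA ler_wpM2l ?addr_ge0 ?normc_ge0//.
  exact: (le_trans hz (ltW hz')).
(* Large enough for ]- K, K[ to contain both [s, 0] and [0, 2 pi]. *)
pose K := 2 * pi - s + 1.
have [A [B [HA HB AA]]] := primitives_of_entire K eh.
have p2 : 0 < 2 * pi :> R by rewrite mulr_gt0.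
have D0 : boundary_increment A B s 0 0 (2 * pi) = 0.
  by apply: (boundary_increment0 eh HA HB); rewrite /K; clear -p2 s0; lra.
have A0 : A (2 * pi) = A 0.
  by apply: AA => u; rewrite -(periodic u 0) add0r.
have BB : B 0 (2 * pi) - B 0 0 = B s (2 * pi) - B s 0.
  by move: D0; rewrite /boundary_increment A0 subrr add0r => /subr0_eq.
have inK x : x \in `[0, 2 * pi] -> x \in `]- K, K[.
  rewrite !in_itv/= => /andP[x0 x2]; rewrite /K; clear -p2 s0 x0 x2.
  by apply/andP; split; lra.
exists (B 0) => [x /inK|]; first exact: HB.
rewrite BB.
have H1 x : x \in `[0, 2 * pi] -> is_derive x 1 (B s) (complex.Re (h (s +i* x))).
  by move=> /inK; exact: HB.
have H2 x : x \in `[0, 2 * pi] ->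
    `|complex.Re (h (s +i* x)) - (complex.Re (f 0) + 0 * x)| <= e.
  by move=> _; rewrite mul0r addr0; exact: near.
have := increment_approx (ltW p2) H1 H2.
by rewrite !mul0r !addr0 subr0 (mulrC _ (2 * pi)).
Qed.

End CircleMean.

(** * Translations and rotations preserve the Lebesgue measure of the plane *)

Section PlaneMeasure.
Context {R : realType}.
Local Notation C := R[i].
Local Notation leb := (@lebesgue_measure R).
Local Notation leb2 := (@lebesgue_measure R \x @lebesgue_measure R)%E.

(** The measurable sets of the plane are generated by rectangles; an open set is the countable union
    of the squares with rational centre and radius that it contains. *)
Lemma measurable_open_plane (A : set (R * R)) : open A -> measurable A.
Proof.
move=> oA.
pose rect (r : rat * rat * rat) : set (R * R) :=
  ball (ratr r.1.1 : R) (ratr r.2) `*` ball (ratr r.1.2 : R) (ratr r.2).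
pose F r := if `[< rect r `<=` A >] then rect r else set0.
have -> : A = \bigcup_r F r.
  apply/seteqP; split => [[x y] Axy|p [r _]]; last first.
    by rewrite /F; case: asboolP => // H /H.
  have [e /= e0 He] : nbhs_ball (x, y) A by apply/nbhs_ballP; exact: oA.
  have [|r] := @rat_in_itvoo R 0 (e / 2); first by rewrite divr_gt0.
  rewrite in_itv/= => /andP[r0 re].
  have near (z : R) : exists a : rat, `|ratr a - z| < ratr r.
    have [|a] := @rat_in_itvoo R (z - ratr r) (z + ratr r).
      by rewrite ltrBlDr -addrA ltrDl addr_gt0.
    rewrite in_itv/= => /andP[h1 h2]; exists a.
    by rewrite ltr_norml; apply/andP; split; lra.
  have [a xa] := near x; have [b yb] := near y.
  exists (a, b, r) => //; rewrite /F; case: asboolP => [_|]; first by split.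
  case=> -[x' y'] [/= xx' yy']; apply: He; split => /=;
    rewrite /ball/= in xx' yy' *; rewrite !ltr_norml in xa yb xx' yy' *;
    by apply/andP; split; lra.
apply: countable_bigcupT_measurable; first exact: countableP.
move=> r; rewrite /F; case: asboolP => // _.
by apply: measurableX; rewrite ball_itv; exact: measurable_itv.
Qed.

Lemma measurable_continuous_plane (u : R * R -> R) :
  continuous u -> measurable_fun setT u.
Proof.
move=> /continuousP cu; apply: (measurability _ (RGenOInfty.measurableE R)).
move=> _ [_ [a ->] <-]; rewrite setTI; apply: measurable_open_plane.
exact/cu/interval_open.
Qed.

Lemma continuous_entire_plane (f : C -> C) : entire f ->
  continuous (fun p : R * R => complex.Re (f (p.1 +i* p.2))) /\
  continuous (fun p : R * R => complex.Im (f (p.1 +i* p.2))).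
Proof.
move=> /entireP ef.
have K (p : R * R) (e : R) : 0 < e ->
    \forall q \near p, normc (f (p.1 +i* p.2) - f (q.1 +i* q.2)) < e.
  move=> e0; have [l Hl] := ef (p.1 +i* p.2).
  have [d d0 Hd] := has_cderiv_lip Hl.
  have L0 : 0 < 1 + normc l by rewrite ltr_wpDr ?normc_ge0.
  pose r := Num.min (d / 2) (e / (1 + normc l) / 2).
  have r0 : 0 < r by rewrite lt_min !divr_gt0.
  apply/nbhs_ballP; exists r => //= -[x y] [/=]; rewrite /ball/= => hx hy.
  set h := (x - p.1) +i* (y - p.2).
  have hE : x +i* y = p.1 +i* p.2 + h by apply: eqc => /=; ring.
  have hr : normc h < 2 * r.
    apply: (le_lt_trans (ler_normc_ReIm _)) => /=.
    by rewrite mulr_natl mulr2n ltrD// distrC.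
  have hd : normc h < d.
    by apply: (lt_le_trans hr); rewrite mulrC -ler_pdivlMr// ge_min lexx.
  rewrite normcB hE; apply: (le_lt_trans (Hd _ hd)).
  rewrite mulrC -ltr_pdivlMr//; apply: (lt_le_trans hr).
  by rewrite mulrC -ler_pdivlMr// ge_min lexx orbT.
split=> p; apply/cvgrPdist_lt => e e0; apply: filterS (K p e e0) => q;
  apply: le_lt_trans.
- by rewrite -cReN -cReD ler_Re_normc.
- by rewrite -cImN -cImD ler_Im_normc.
Qed.

(** The image of the Lebesgue measure under the translation gives intervals their length, and this
    determines the measure. *)
Lemma integral_translation (F : R -> \bar R) (a : R) : measurable_fun [set: R] F ->
  (forall x, 0 <= F x)%E -> (\int[leb]_x F (x + a)%R = \int[leb]_x F x)%E.
Proof.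
move=> mF F0.
have mt : measurable_fun setT (fun x : measurableTypeR R => (x + a : measurableTypeR R)).
  exact: measurable_funD.
have := @ge0_integral_pushforward _ _ (measurableTypeR R) (measurableTypeR R) R _ mt leb
  setT F measurableT mF (fun y _ => F0 y).
rewrite preimage_setT => <-.
apply: eq_measure_integral => A mA _.
apply/esym/lebesgue_measure_unique => //= _ [[b c]] _ <-.
rewrite /pushforward [X in _ = leb X](_ : _ = `]b - a, c - a]%classic); last first.
  by apply/seteqP; split=> x; rewrite /= !in_itv/= ltrBlDr lerBrDr.
rewrite /= !lebesgue_measure_itv/= !lte_fin ltrD2r.
by case: ifP => // _; congr EFin; ring.
Qed.

(** Invariance is expressed by integrals of nonnegative functions rather than by measures of sets:
    this is the form that Tonelli's theorem delivers and that composes directly. *)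
Definition plane_preserving (T : R * R -> R * R) :=
  measurable_fun setT T /\ forall F : R * R -> \bar R, measurable_fun setT F ->
    (forall p, 0 <= F p)%E -> (\int[leb2]_p F (T p) = \int[leb2]_p F p)%E.

Lemma plane_preserving_comp S T : plane_preserving S -> plane_preserving T ->
  plane_preserving (S \o T).
Proof.
move=> [mS pS] [mT pT]; split; first exact: measurableT_comp.
move=> F mF F0; rewrite (pT (F \o S) (measurableT_comp mF mS) (fun p => F0 _)).
exact: pS.
Qed.

(** By Tonelli's theorem with the sheared coordinate integrated first: for fixed y the shear is a
    translation of the line by phi y. *)
Lemma plane_preserving_shear1 (phi : R -> R) : measurable_fun [set: R] phi ->
  plane_preserving (fun p => (p.1 + phi p.2, p.2)).
Proof.
move=> mphi.
have mT : measurable_fun setT (fun p : R * R => (p.1 + phi p.2, p.2)).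
  apply: measurable_fun_pair; last exact: measurable_snd.
  by apply: measurable_funD; [exact: measurable_fst|exact: measurableT_comp].
split=> // F mF F0.
have mFT : measurable_fun setT (fun p : R * R => F (p.1 + phi p.2, p.2)).
  exact: (measurableT_comp mF mT).
transitivity (\int[leb]_z fubini_G leb (fun p => F ((p.1 + phi p.2)%R, p.2)) z)%E.
  exact: (fubini_tonelli2 (m1 := leb) (m2 := leb) _ mFT (fun p => F0 _)).
transitivity (\int[leb]_z fubini_G leb F z)%E; last first.
  by apply/esym; exact: (fubini_tonelli2 (m1 := leb) (m2 := leb) _ mF F0).
apply: eq_integral => y _; rewrite /fubini_G /=.
apply: (integral_translation (phi y) _ (fun x => F0 (x, y))).
exact: (measurableT_comp mF (measurable_pair2 y)).
Qed.

Lemma plane_preserving_shear2 (phi : R -> R) : measurable_fun [set: R] phi ->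
  plane_preserving (fun p => (p.1, p.2 + phi p.1)).
Proof.
move=> mphi.
have mT : measurable_fun setT (fun p : R * R => (p.1, p.2 + phi p.1)).
  apply: measurable_fun_pair; first exact: measurable_fst.
  by apply: measurable_funD; [exact: measurable_snd|exact: measurableT_comp].
split=> // F mF F0.
have mFT : measurable_fun setT (fun p : R * R => F (p.1, p.2 + phi p.1)).
  exact: (measurableT_comp mF mT).
transitivity (\int[leb]_z fubini_F leb (fun p => F (p.1, (p.2 + phi p.1)%R)) z)%E.
  exact: (fubini_tonelli1 (m1 := leb) (m2 := leb) _ mFT (fun p => F0 _)).
transitivity (\int[leb]_z fubini_F leb F z)%E; last first.
  by apply/esym; exact: (fubini_tonelli1 (m1 := leb) (m2 := leb) _ mF F0).
apply: eq_integral => x _; rewrite /fubini_F /=.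
apply: (integral_translation (phi x) _ (fun y => F0 (x, y))).
exact: (measurableT_comp mF (measurable_pair1 x)).
Qed.

Lemma plane_preserving_translation (a b : R) :
  plane_preserving (fun p => (p.1 + a, p.2 + b)).
Proof.
have := plane_preserving_comp (@plane_preserving_shear1 (cst a) (measurable_cst _))
  (@plane_preserving_shear2 (cst b) (measurable_cst _)).
by [].
Qed.

(* For (c, s) <> (-1, 0) a rotation is a product of three shears; the remaining
   one is the square of the quarter turn. *)
Lemma plane_preserving_rotation (c s : R) : c ^+ 2 + s ^+ 2 = 1 ->
  plane_preserving (fun p => (c * p.1 - s * p.2, s * p.1 + c * p.2)).
Proof.
have mlin (k : R) : measurable_fun [set: R] (fun x : R => k * x).
  exact: mulrl_measurable.
have main (c' s' : R) : c' ^+ 2 + s' ^+ 2 = 1 -> 1 + c' != 0 ->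
    plane_preserving (fun p => (c' * p.1 - s' * p.2, s' * p.1 + c' * p.2)).
  (* The tangent of the half angle; [ts] and [tc] are the half-angle identities that make the three
     shears compose to the rotation. *)
  move=> cs c1; pose t := s' / (1 + c').
  have H1 := plane_preserving_shear1 (mlin (- t)).
  have H2 := plane_preserving_shear2 (mlin s').
  have := plane_preserving_comp H1 (plane_preserving_comp H2 H1).
  congr plane_preserving; apply/funext => -[x y] /=.
  have ts : t * s' = 1 - c'.
    by rewrite /t mulrAC -expr2 -(addKr (c' ^+ 2) (s' ^+ 2)) cs; field.
  have tc : t * (1 + c') = s' by rewrite /t divfK.
  congr pair.
    have -> : x + - t * y + - t * (y + s' * (x + - t * y)) =
      (1 - t * s') * x - (t * (2 - t * s')) * y by ring.
    by rewrite ts (_ : 2 - (1 - c') = 1 + c') ?tc; ring.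
  have -> : y + s' * (x + - t * y) = s' * x + (1 - t * s') * y by ring.
  by rewrite ts; ring.
move=> cs; have [c1|c1] := eqVneq (1 + c) 0; last exact: main.
have c1' : c = -1 by apply/eqP; rewrite -addr_eq0 addrC c1.
have s0 : s = 0.
  by apply/eqP; rewrite -sqrf_eq0; move: cs; rewrite c1' sqrrN expr1n; lra.
have Q : plane_preserving (fun p => (0 * p.1 - 1 * p.2, 1 * p.1 + 0 * p.2)).
  by apply: main; rewrite ?expr0n/= ?expr1n ?addr0 ?add0r ?oner_eq0.
have := plane_preserving_comp Q Q.
congr plane_preserving; apply/funext => -[x y] /=.
by congr pair; rewrite c1' s0; ring.
Qed.

Lemma plane_preserving_integral T (F : R * R -> \bar R) : plane_preserving T ->
  measurable_fun setT F -> (\int[leb2]_p F (T p) = \int[leb2]_p F p)%E.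
Proof.
move=> [mT pT] mF.
rewrite integralE [in RHS]integralE; congr (_ - _)%E.
  rewrite -(pT (F^\+)%E (measurable_funepos mF) (funepos_ge0 F)). by apply: eq_integral => p _; rewrite !funeposE.
rewrite -(pT (F^\-)%E (measurable_funeneg mF) (funeneg_ge0 F)).
by apply: eq_integral => p _; rewrite !funenegE.
Qed.

Lemma plane_preserving_integrable T (F : R * R -> \bar R) : plane_preserving T ->
  leb2.-integrable setT F -> leb2.-integrable setT (fun p => F (T p)).
Proof.
move=> [mT pT] /integrableP[mF F1]; apply/integrableP; split.
  exact: (measurableT_comp mF mT).
by rewrite (pT (fun p => `|F p|)%E)//; exact: (measurableT_comp _ mF).
Qed.

End PlaneMeasure.

(** * The Gaussian mean of an entire function over the plane *)

Lemma sigma_finite_plane (R : realType) :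
  sigma_finite setT (@lebesgue_measure R \x @lebesgue_measure R)%E.
Proof.
pose I n : set R := `[- n%:R, n%:R]%classic.
have mI n : measurable (I n) by exact: measurable_itv.
exists (fun n => I n `*` I n).
  apply/seteqP; split=> // -[x y] _.
  pose n := (Num.truncn (Num.max `|x| `|y|)).+1.
  have : Num.max `|x| `|y| < n%:R := truncnS_gt _.
  rewrite gt_max => /andP[xn yn]; exists n => //; split.
  - by rewrite /I/= in_itv/= -ler_norml; exact: ltW xn.
  - by rewrite /I/= in_itv/= -ler_norml; exact: ltW yn.
move=> n; split; first by apply: measurableX; exact: mI.
rewrite (product_measure1E (@lebesgue_measure R) (@lebesgue_measure R) (mI n) (mI n)).
by rewrite /I/= lebesgue_measure_itv/=; case: ifP => _; rewrite ?mul0e ?ltry.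
Qed.

(** The product measure bundled as a sigma-finite measure, so that the plane can itself be a factor
    in Fubini's theorem. *)
Definition plane_measure (R : realType) :
  {sigma_finite_measure set (measurableTypeR R * measurableTypeR R)%type -> \bar R} :=
  HB.pack_for {sigma_finite_measure set (measurableTypeR R * measurableTypeR R)%type -> \bar R}
    (@lebesgue_measure R \x @lebesgue_measure R)%E
    (@Measure_isSigmaFinite.Build _ _ _ (@lebesgue_measure R \x @lebesgue_measure R)%E
       (sigma_finite_plane R)).

Section PlaneMean.
Context {R : realType}.
Local Notation C := R[i].
Local Notation leb := (@lebesgue_measure R).
Local Notation leb2 := (@lebesgue_measure R \x @lebesgue_measure R)%E.

Definition gauss2 (p : R * R) : R := expR (- (p.1 ^+ 2 + p.2 ^+ 2)).

Lemma gauss2E (p : R * R) : gauss2 p = gauss_fun p.1 * gauss_fun p.2.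
Proof. by rewrite /gauss2 /gauss_fun opprD expRD. Qed.

Lemma gauss2_ge0 (p : R * R) : 0 <= gauss2 p.
Proof. exact: expR_ge0. Qed.

Lemma measurable_gauss2 : measurable_fun setT gauss2.
Proof.
rewrite (_ : gauss2 = fun p => gauss_fun p.1 * gauss_fun p.2); last first.
  by apply/funext => p; rewrite gauss2E.
by apply: measurable_funM; (apply: measurableT_comp; first exact: measurable_gauss_fun);
  [exact: measurable_fst|exact: measurable_snd].
Qed.

Lemma integral_gauss2 : (\int[leb2]_p (gauss2 p)%:E = pi%:E)%E.
Proof.
have mg : measurable_fun setT (EFin \o gauss2).
  by apply/measurable_EFinP; exact: measurable_gauss2.
have g0 p : (0 <= (EFin \o gauss2) p)%E by rewrite lee_fin gauss2_ge0.
have mg1 : measurable_fun [set: R] (EFin \o @gauss_fun R).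
  by apply/measurable_EFinP; exact: measurable_gauss_fun.
have g10 (x : R) : (0 <= (gauss_fun x)%:E)%E by rewrite lee_fin gauss_fun_ge0.
transitivity (\int[leb]_z fubini_F leb (EFin \o gauss2) z)%E.
  exact: (fubini_tonelli1 (m1 := leb) (m2 := leb) _ mg g0).
transitivity (\int[leb]_x ((gauss_fun x)%:E * (Num.sqrt pi)%:E))%E.
  apply: eq_integral => x _; rewrite /fubini_F -integralT_gauss -ge0_integralZl//.
  by apply: eq_integral => y _; rewrite /= gauss2E.
rewrite ge0_integralZr// ?lee_fin ?sqrtr_ge0// integralT_gauss -EFinM.
by rewrite -expr2 sqr_sqrtr// pi_ge0.
Qed.

Lemma integrable_gauss2 : leb2.-integrable setT (fun p => (gauss2 p)%:E).
Proof.
apply/integrableP; split.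
  by apply/measurable_EFinP; exact: measurable_gauss2.
under eq_integral do rewrite gee0_abs ?lee_fin ?gauss2_ge0//.
by rewrite integral_gauss2 ltry.
Qed.

(* Rotation by - t: it multiplies p.1 -i* p.2 by cos t +i* sin t. *)
Definition rotation (t : R) (p : R * R) : R * R :=
  (cos t * p.1 - (- sin t) * p.2, - sin t * p.1 + cos t * p.2).

Lemma plane_preservingT (t : R) : plane_preserving (rotation t).
Proof. by apply: plane_preserving_rotation; rewrite sqrrN cos2Dsin2. Qed.

Lemma gauss2_rotation t p : gauss2 (rotation t p) = gauss2 p.
Proof.
congr (expR (- _)) => /=; have := cos2Dsin2 t.
move: (cos t) (sin t) p.1 p.2 => c s x y cs.
rewrite (_ : _ + _ = (c ^+ 2 + s ^+ 2) * (x ^+ 2 + y ^+ 2)); last by ring.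
by rewrite cs mul1r.
Qed.

Lemma measurable_rotation :
  measurable_fun setT (fun q : (R * R) * R => rotation q.2 q.1).
Proof.
have m1 : measurable_fun setT (fun q : (R * R) * R => q.1.1).
  by apply: measurableT_comp; [exact: measurable_fst|exact: measurable_fst].
have m2 : measurable_fun setT (fun q : (R * R) * R => q.1.2).
  by apply: measurableT_comp; [exact: measurable_snd|exact: measurable_fst].
have mc : measurable_fun setT (fun q : (R * R) * R => cos q.2).
  apply: measurableT_comp; last exact: measurable_snd.
  by apply: continuous_measurable_fun; exact: continuous_cos.
have ms : measurable_fun setT (fun q : (R * R) * R => - sin q.2).
  apply: measurableT_comp => //; apply: measurableT_comp; last exact: measurable_snd.
  by apply: continuous_measurable_fun; exact: continuous_sin.
by apply: measurable_fun_pair; [apply: measurable_funB|apply: measurable_funD];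
  apply: measurable_funM.
Qed.

Lemma measurable_entire_plane (f : C -> C) : entire f ->
  measurable_fun setT (fun p : R * R => complex.Re (f (p.1 -i* p.2))) /\
  measurable_fun setT (fun p : R * R => complex.Im (f (p.1 -i* p.2))).
Proof.
move=> ef.
have mN : measurable_fun setT (fun p : R * R => (p.1, - p.2)).
  apply: measurable_fun_pair; first exact: measurable_fst.
  by apply: measurableT_comp => //; exact: measurable_snd.
have [c1 c2] := continuous_entire_plane ef.
split.
- exact: (measurableT_comp (measurable_continuous_plane c1) mN).
- exact: (measurableT_comp (measurable_continuous_plane c2) mN).
Qed.

(** The function v composed with the rotation of angle t is integrated over the plane and over t in
    [0, 2 pi]. Integrating over the plane first gives 2 pi times the wanted integral, by invariance;
    integrating over t first gives 2 pi Re (f 0) times the rotation invariant Gaussian, by the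
    circle mean. *)
Lemma plane_mean_Re (f : C -> C) : entire f ->
  leb2.-integrable setT (fun p => (complex.Re (f (p.1 -i* p.2)) * gauss2 p)%:E) ->
  (\int[leb2]_p (complex.Re (f (p.1 -i* p.2)) * gauss2 p)%:E =
    (pi * complex.Re (f 0))%:E)%E.
Proof.
move=> ef.
set v := fun p : R * R => (complex.Re (f (p.1 -i* p.2)) * gauss2 p)%R.
move=> iv.
have mv : measurable_fun setT v.
  apply: measurable_funM; last exact: measurable_gauss2.
  exact: (measurable_entire_plane ef).1.
pose D : set R := `[0, 2 * pi]%classic.
have mD : measurable D by exact: measurable_itv.
pose g (q : (R * R) * R) : R := v (rotation q.2 q.1) * \1_D q.2.
have mg : measurable_fun setT (EFin \o g).
  apply/measurable_EFinP; apply: measurable_funM.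
    exact: (measurableT_comp mv measurable_rotation).
  by apply: measurableT_comp; [exact: measurable_indic|exact: measurable_snd].
set I := (\int[leb2]_p (v p)%:E)%E.
have Ifin : I \is a fin_num by exact: integrable_fin_num.
have inner2 t : (\int[leb2]_p (g (p, t))%:E = ((cst I) \_ D) t)%E.
  rewrite patchE; case: ifP => tD.
    transitivity (\int[leb2]_p (v (rotation t p))%:E)%E.
      by apply: eq_integral => p _; rewrite /g /= indicE tD mulr1.
    apply: (plane_preserving_integral (F := EFin \o v) (plane_preservingT t)).
    exact/measurable_EFinP.
  by rewrite integral0_eq// => p _; rewrite /g /= indicE tD mulr0.
have piD : (leb D = (2 * pi)%:E)%E.
  by rewrite lebesgue_measure_itv/= lte_fin mulr_gt0 ?pi_gt0// sube0.
have iD c : (\int[leb]_(t in D) cst c t = c * (2 * pi)%:E)%E.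
  by rewrite integral_cst//; congr (_ * _)%E; exact: piD.
(* The integral of |g| over the plane is the same for every t in D, so the total is 2 pi times the
   finite integral of |v|. *)
have ig : (leb2 \x leb)%E.-integrable setT (EFin \o g).
  apply/(@integrable21ltyP _ _ (measurableTypeR R * measurableTypeR R)%type
    (measurableTypeR R) R (plane_measure R) leb _ mg).
  rewrite [ltLHS](_ : _ = \int[leb]_(t in D) cst (\int[leb2]_p `|(v p)%:E|) t)%E.
    rewrite iD lte_mul_pinfty ?integral_ge0// ?lee_fin ?ltry//.
    by rewrite ge0_fin_numE ?integral_ge0//; have /integrableP[] := iv.
  rewrite [RHS]integral_mkcond; apply: eq_integral => t _.
  rewrite patchE; case: ifP => tD.
    transitivity (\int[leb2]_p (abse \o (EFin \o v)) (rotation t p))%E.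
      by apply: eq_integral => p _; rewrite /g /= indicE tD mulr1.
    apply: (plane_preserving_integral (plane_preservingT t)).
    by apply: measurableT_comp => //; exact/measurable_EFinP.
  by rewrite integral0_eq// => p _; rewrite /g /= indicE tD mulr0 normr0.
have := @Fubini _ _ (measurableTypeR R * measurableTypeR R)%type (measurableTypeR R) R
  (plane_measure R) leb (EFin \o g) ig.
rewrite [RHS](_ : _ = \int[leb]_(t in D) cst I t)%E; last first.
  rewrite [RHS]integral_mkcond; apply: eq_integral => t _; exact: inner2.
rewrite iD.
rewrite [LHS](_ : _ = \int[leb2]_p ((2 * pi * complex.Re (f 0))%:E * (gauss2 p)%:E))%E.
  rewrite integralZl//; last exact: integrable_gauss2.
  rewrite integral_gauss2 -(fineK Ifin) -!EFinM => -[] H; congr EFin.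
  have p0 : 0 < pi :> R := pi_gt0 R.
  apply: (@mulIf _ (2 * pi)); first by rewrite mulf_neq0// gt_eqF.
  by rewrite -H; ring.
apply: eq_integral => p _.
rewrite -EFinM (_ : _ * gauss2 p = 2 * pi * complex.Re ((gauss2 p)%:C * f 0)); last first.
  by rewrite cReM /=; ring.
(* For fixed p the Gaussian is a constant along the circle and is absorbed into the entire
   function. *)
have eg := @entireZ R (gauss2 p)%:C f ef.
rewrite -(circle_mean (p.1 -i* p.2) eg) [RHS]integral_mkcond.
apply: eq_integral => t _; rewrite patchE /g /= indicE; case: ifP => tD; last by rewrite mulr0.
rewrite mulr1 /v gauss2_rotation mulrC cReM /= mul0r subr0; congr (_ * complex.Re (f _))%:E.
by apply: eqc => /=; ring.
Qed.

End PlaneMean.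

(** * Complex-valued integrals and dominated convergence *)

Section ComplexIntegral.
Context {R : realType}.
Local Notation C := R[i].
Local Notation leb2 := (@lebesgue_measure R \x @lebesgue_measure R)%E.
Implicit Types (F G : R * R -> C) (f : C -> C).

Definition measurableC F :=
  measurable_fun setT (fun p => complex.Re (F p)) /\
  measurable_fun setT (fun p => complex.Im (F p)).

Lemma measurableC_cst c : measurableC (cst c).
Proof. by split; exact: measurable_cst. Qed.

Lemma measurableCM F G : measurableC F -> measurableC G ->
  measurableC (fun p => F p * G p).
Proof.
move=> [F1 F2] [G1 G2]; split.
- rewrite (_ : (fun p => _) = fun p => complex.Re (F p) * complex.Re (G p) -
    complex.Im (F p) * complex.Im (G p)); last by apply/funext => p; rewrite cReM.
  by apply: measurable_funB; apply: measurable_funM.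
- rewrite (_ : (fun p => _) = fun p => complex.Re (F p) * complex.Im (G p) +
    complex.Im (F p) * complex.Re (G p)); last by apply/funext => p; rewrite cImM.
  by apply: measurable_funD; apply: measurable_funM.
Qed.

Lemma measurableCX n F : measurableC F -> measurableC (fun p => F p ^+ n).
Proof.
move=> mF; elim: n => [|n IH]; first exact: (measurableC_cst 1).
rewrite (_ : (fun p => _) = fun p => F p * F p ^+ n); first exact: measurableCM.
by apply/funext => p; rewrite exprS.
Qed.

Lemma measurableC_sum n (F : nat -> R * R -> C) : (forall k, measurableC (F k)) ->
  measurableC (fun p => \sum_(0 <= k < n) F k p).
Proof.
move=> mF; elim: n => [|n [IH1 IH2]].
  rewrite (_ : (fun p => _) = cst 0); first exact: measurableC_cst.
  by apply/funext => p; rewrite big_geq.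
split.
- rewrite (_ : (fun p => _) = fun p => complex.Re (\sum_(0 <= k < n) F k p) +
      complex.Re (F n p)); first by apply: measurable_funD => //; case: (mF n).
  by apply/funext => p; rewrite big_nat_recr//= cReD.
- rewrite (_ : (fun p => _) = fun p => complex.Im (\sum_(0 <= k < n) F k p) +
      complex.Im (F n p)); first by apply: measurable_funD => //; case: (mF n).
  by apply/funext => p; rewrite big_nat_recr//= cImD.
Qed.

Lemma measurableC_real (u : R * R -> R) : measurable_fun setT u ->
  measurableC (fun p => (u p)%:C).
Proof. by move=> mu; split => //; exact: measurable_cst. Qed.

Lemma measurableC_conj F : measurableC F -> measurableC (fun p => (F p)^*%C).
Proof.
move=> [F1 F2]; split.
- by rewrite (_ : (fun p => _) = fun p => complex.Re (F p))//; apply/funext => p; case: (F p).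
- rewrite (_ : (fun p => _) = fun p => - complex.Im (F p)).
    by apply: measurableT_comp.
  by apply/funext => p; case: (F p).
Qed.

Lemma measurableC_normc F : measurableC F -> measurable_fun setT (fun p => normc (F p)).
Proof.
move=> [F1 F2].
rewrite (_ : (fun p => _) = fun p =>
    Num.sqrt (complex.Re (F p) ^+ 2 + complex.Im (F p) ^+ 2)); last first.
  by apply/funext => p; case: (F p).
apply: measurableT_comp.
  by apply: continuous_measurable_fun; exact: sqrt_continuous.
by apply: measurable_funD; apply: measurable_funX.
Qed.

Lemma measurableC_entire f : entire f ->
  measurableC (fun p => f (p.1 +i* p.2)) /\ measurableC (fun p => f (p.1 -i* p.2)).
Proof.
move=> ef; have [c1 c2] := continuous_entire_plane ef.
split; last exact: measurable_entire_plane.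
by split; exact: measurable_continuous_plane.
Qed.

Lemma integrable_plane_le (u v : R * R -> R) : measurable_fun setT u ->
  leb2.-integrable setT (fun p => (v p)%:E) -> (forall p, `|u p| <= v p) ->
  leb2.-integrable setT (fun p => (u p)%:E).
Proof.
move=> mu iv uv; apply: (le_integrable _ _ _ iv) => //.
  exact/measurable_EFinP.
move=> p _; rewrite /= lee_fin; apply: (le_trans (uv p)); exact: ler_norm.
Qed.

Lemma integrableC_le F (G : R * R -> R) : measurableC F ->
  leb2.-integrable setT (fun p => (G p)%:E) -> (forall p, normc (F p) <= G p) ->
  integrableC F.
Proof.
move=> [F1 F2] iG FG; split; apply: (integrable_plane_le _ iG) => // p.
- exact: (le_trans (ler_Re_normc _)).
- exact: (le_trans (ler_Im_normc _)).
Qed.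

Lemma integralCZ c F : integrableC F ->
  integralC (fun p => c * F p) = c * integralC F.
Proof.
move=> [F1 F2]; apply: eqc; rewrite /= ?cReM ?cImM /=.
- transitivity (\int[leb2]_p (complex.Re c * complex.Re (F p) +
    (- complex.Im c) * complex.Im (F p)))%R.
    by congr Rintegral; apply/funext => p; rewrite cReM mulNr.
  rewrite (RintegralD (mu := plane_measure R))//.
  + by rewrite !(RintegralZl (mu := plane_measure R))// mulNr.
  + exact: (integrableZl (mu := plane_measure R) measurableT _ F1).
  + exact: (integrableZl (mu := plane_measure R) measurableT _ F2).
- transitivity (\int[leb2]_p (complex.Re c * complex.Im (F p) +
    complex.Im c * complex.Re (F p)))%R.
    by congr Rintegral; apply/funext => p; rewrite cImM.
  rewrite (RintegralD (mu := plane_measure R))//.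
  + by rewrite !(RintegralZl (mu := plane_measure R)).
  + exact: (integrableZl (mu := plane_measure R) measurableT _ F2).
  + exact: (integrableZl (mu := plane_measure R) measurableT _ F1).
Qed.

Lemma integralCD F G : integrableC F -> integrableC G ->
  integralC (fun p => F p + G p) = integralC F + integralC G.
Proof.
move=> [F1 F2] [G1 G2]; apply: eqc; rewrite /= ?cReD ?cImD /=.
- rewrite -(RintegralD (mu := plane_measure R))//.
  by congr Rintegral; apply/funext => p; rewrite cReD.
- rewrite -(RintegralD (mu := plane_measure R))//.
  by congr Rintegral; apply/funext => p; rewrite cImD.
Qed.

Lemma integrableCD F G : integrableC F -> integrableC G ->
  integrableC (fun p => F p + G p).
Proof.
move=> [F1 F2] [G1 G2]; split.
- rewrite (_ : (fun p => _) = ((fun p => (complex.Re (F p))%:E) \+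
    (fun p => (complex.Re (G p))%:E))%E); last by apply/funext => p; rewrite cReD.
  exact: (integrableD (mu := plane_measure R)).
- rewrite (_ : (fun p => _) = ((fun p => (complex.Im (F p))%:E) \+
    (fun p => (complex.Im (G p))%:E))%E); last by apply/funext => p; rewrite cImD.
  exact: (integrableD (mu := plane_measure R)).
Qed.

Lemma integralC0 : integralC (fun=> 0 : C) = 0.
Proof.
have i0 : integrableC (fun=> 0 : C).
  by split => /=; exact: (integrable0 (plane_measure R) setT).
by have := integralCZ 0 i0; rewrite !mul0r.
Qed.

Lemma integralC_sum n (F : nat -> R * R -> C) : (forall k, integrableC (F k)) ->
  integralC (fun p => \sum_(0 <= k < n) F k p) = \sum_(0 <= k < n) integralC (F k) /\
  integrableC (fun p => \sum_(0 <= k < n) F k p).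
Proof.
move=> iF; elim: n => [|n [IH1 IH2]].
  rewrite big_geq// (_ : (fun p => _) = fun=> 0); last first.
    by apply/funext => p; rewrite big_geq.
  rewrite integralC0; split => //.
  by split => /=; exact: (integrable0 (plane_measure R) setT).
rewrite (_ : (fun p => _) = fun p => \sum_(0 <= k < n) F k p + F n p); last first.
  by apply/funext => p; rewrite big_nat_recr.
by rewrite big_nat_recr//= integralCD// IH1; split => //; exact: integrableCD.
Qed.

Lemma integralC_preserving T F : plane_preserving T -> measurableC F ->
  integralC (fun p => F (T p)) = integralC F.
Proof.
move=> pT [F1 F2]; apply: eqc; rewrite /= /Rintegral; congr fine.
- apply: (plane_preserving_integral (F := fun p => (complex.Re (F p))%:E) pT).
  exact/measurable_EFinP.
- apply: (plane_preserving_integral (F := fun p => (complex.Im (F p))%:E) pT).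
  exact/measurable_EFinP.
Qed.

Lemma cvgC_ReIm (u : nat -> C) (l : C) :
  (fun n => complex.Re (u n)) @ \oo --> complex.Re l ->
  (fun n => complex.Im (u n)) @ \oo --> complex.Im l -> u @ \oo --> l.
Proof.
move=> h1 h2; apply: cvgC_normc.
apply/cvgrPdist_lt => e e0.
have e20 : 0 < e / 2 by rewrite divr_gt0.
move/cvgrPdist_lt : h1 => /(_ _ e20) h1.
move/cvgrPdist_lt : h2 => /(_ _ e20) h2.
near=> n.
rewrite sub0r normrN ger0_norm ?normc_ge0//.
apply: (le_lt_trans (ler_normc_ReIm _)); rewrite cReD cImD cReN cImN [ltRHS]splitr.
by rewrite ltrD// distrC; near: n.
Unshelve. all: by end_near. Qed.

Lemma dominated_cvgC (F_ : nat -> R * R -> C) F (G : R * R -> R) :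
  (forall n, measurableC (F_ n)) -> measurableC F ->
  (forall p, (fun n => normc (F_ n p - F p)) @ \oo --> (0 : R)) ->
  leb2.-integrable setT (fun p => (G p)%:E) ->
  (forall n p, normc (F_ n p) <= G p) ->
  (fun n => integralC (F_ n)) @ \oo --> integralC F.
Proof.
move=> mFn mF cF iG bF.
have iFn n : integrableC (F_ n) by apply: integrableC_le iG _.
have bF' p : normc (F p) <= G p.
  apply/ler_addgt0Pl => e e0.
  have /cvgrPdist_lt/(_ _ e0)[n _ Hn] := cF p.
  have := Hn n (leqnn _); rewrite /= sub0r normrN ger0_norm ?normc_ge0// => h.
  rewrite -(subrK (F_ n p) (F p)); apply: (le_trans (le_normcD _ _)).
  by rewrite normcB lerD// ltW.
have iF : integrableC F by apply: integrableC_le iG _.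
(* Here c stands for either component, being 1-Lipschitz and bounded by the modulus. *)
have comp (c : C -> R) : (forall z w, `|c z - c w| <= normc (z - w)) ->
    (forall z, `|c z| <= normc z) ->
    (forall n, measurable_fun setT (fun p => c (F_ n p))) ->
    measurable_fun setT (fun p => c (F p)) ->
    leb2.-integrable setT (fun p => (c (F p))%:E) ->
    (fun n => (\int[leb2]_p c (F_ n p))%R) @ \oo --> (\int[leb2]_p c (F p))%R.
  move=> c1 c2 m1 m2 ic; rewrite /Rintegral; apply: fine_cvg.
  rewrite fineK; last exact: (integrable_fin_num (mu := plane_measure R)).
  apply: (@dominated_cvg _ _ _ (plane_measure R) setT measurableT _ _ (fun p => (G p)%:E)) => //.
  - by move=> n; apply/measurable_EFinP; exact: m1.
  - move=> p _; apply/cvg_EFin; first exact: nearW.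
    apply/cvgrPdist_lt => e e0; have /cvgrPdist_lt/(_ _ e0) := cF p.
    apply: filterS => n; rewrite sub0r normrN ger0_norm ?normc_ge0//.
    by apply: le_lt_trans; rewrite normcB; exact: c1.
  - by move=> n p _; rewrite lee_fin (le_trans (c2 _)).
have Re1 z w : `|complex.Re z - complex.Re w| <= normc (z - w) :> R.
  by rewrite -cReN -cReD ler_Re_normc.
have Im1 z w : `|complex.Im z - complex.Im w| <= normc (z - w) :> R.
  by rewrite -cImN -cImD ler_Im_normc.
have HRe := comp _ Re1 (@ler_Re_normc R) (fun n => (mFn n).1) mF.1 iF.1.
have HIm := comp _ Im1 (@ler_Im_normc R) (fun n => (mFn n).2) mF.2 iF.2.
by apply: cvgC_ReIm; [exact: HRe|exact: HIm].
Qed.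

(** The imaginary part follows from the real one applied to - i f. *)
Lemma plane_mean f : entire f ->
  integrableC (fun p => f (p.1 -i* p.2) * (gauss2 p)%:C) ->
  integralC (fun p => f (p.1 -i* p.2) * (gauss2 p)%:C) = pi%:C * f 0.
Proof.
move=> ef [i1 i2].
have ReE p : complex.Re (f (p.1 -i* p.2) * (gauss2 p)%:C) =
    complex.Re (f (p.1 -i* p.2)) * gauss2 p.
  by rewrite cReM /= mulr0 subr0.
have ImE p : complex.Im (f (p.1 -i* p.2) * (gauss2 p)%:C) =
    complex.Re (- 'i * f (p.1 -i* p.2)) * gauss2 p.
  by rewrite cImM cReM /=; ring.
apply: eqc; rewrite /= /Rintegral ?cReM ?cImM /= !mul0r ?subr0 ?addr0.
- move: i1; under eq_integral do rewrite ReE.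
  under [X in integrable _ _ X]eq_fun do rewrite ReE.
  by move=> i1; rewrite plane_mean_Re.
- move: i2; under eq_integral do rewrite ImE.
  under [X in integrable _ _ X]eq_fun do rewrite ImE.
  move=> i2; have eif := @entireZ R (- 'i) f ef.
  rewrite (plane_mean_Re eif i2) /= cReM /=; ring.
Qed.

End ComplexIntegral.

(** * Gaussian growth and the reproducing property *)

Section Reproducing.
Context {R : realType}.
Local Notation C := R[i].
Local Notation leb2 := (@lebesgue_measure R \x @lebesgue_measure R)%E.
Implicit Types (f : C -> C) (p : R * R).

Lemma gauss2_normc p : gauss2 p = expR (- normc (p.1 +i* p.2) ^+ 2).
Proof. by rewrite normc_sqr. Qed.

Lemma gaussE p : gauss (p.1 +i* p.2) = gauss2 p / pi.
Proof. by rewrite /gauss gauss2_normc. Qed.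

Lemma measurable_normc_plane :
  measurable_fun setT (fun p => normc (p.1 +i* p.2)).
Proof.
by apply: measurableC_normc; split; [exact: measurable_fst|exact: measurable_snd].
Qed.

Lemma measurable_exp_gauss (k : R) :
  measurable_fun setT (fun p => expR (k * normc (p.1 +i* p.2)) * gauss2 p).
Proof.
apply: measurable_funM; last exact: measurable_gauss2.
apply: measurableT_comp => //; apply: measurable_funM; first exact: measurable_cst.
exact: measurable_normc_plane.
Qed.

Lemma integrable_plane_translation (u : R * R -> R) (a b : R) :
  leb2.-integrable setT (fun p => (u p)%:E) ->
  leb2.-integrable setT (fun p => (u (p.1 + a, p.2 + b))%:E).
Proof.
move=> iu; exact: (plane_preserving_integrable (plane_preserving_translation a b) iu).
Qed.

Lemma integrable_planeZ (c : R) (u : R * R -> R) :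
  leb2.-integrable setT (fun p => (u p)%:E) ->
  leb2.-integrable setT (fun p => (c * u p)%:E).
Proof. exact: (integrableZl (mu := plane_measure R) measurableT c). Qed.

Lemma integrable_planeD (u v : R * R -> R) :
  leb2.-integrable setT (fun p => (u p)%:E) ->
  leb2.-integrable setT (fun p => (v p)%:E) ->
  leb2.-integrable setT (fun p => (u p + v p)%:E).
Proof. exact: (integrableD (mu := plane_measure R) measurableT). Qed.

(** Completing the square exhibits a multiple of the Gaussian centred at (a / 2, b / 2). *)
Lemma integrable_exp_linear_gauss (a b : R) :
  leb2.-integrable setT (fun p => (expR (a * p.1 + b * p.2) * gauss2 p)%:E).
Proof.
rewrite (_ : (fun p => _) = fun p =>
    (expR ((a ^+ 2 + b ^+ 2) / 4) * gauss2 (p.1 + (- a / 2), p.2 + (- b / 2)))%:E).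
  exact/integrable_planeZ/integrable_plane_translation/integrable_gauss2.
apply/funext => p; congr EFin; rewrite /gauss2 -!expRD; congr expR => /=.
by field.
Qed.

(** With |u| <= |x| + |y| and exp |t| <= exp t + exp (- t), the integrand is dominated by four
    Gaussians with linear exponents, one for each choice of signs. *)
Lemma integrable_exp_gauss (k : R) :
  leb2.-integrable setT (fun p => (expR (k * normc (p.1 +i* p.2)) * gauss2 p)%:E).
Proof.
apply: (@integrable_plane_le _ _ (fun p =>
  (expR (k * p.1 + k * p.2) * gauss2 p + expR (k * p.1 + (- k) * p.2) * gauss2 p) +
  (expR ((- k) * p.1 + k * p.2) * gauss2 p + expR ((- k) * p.1 + (- k) * p.2) * gauss2 p))).
- exact: measurable_exp_gauss.
- by do 2 apply: integrable_planeD; exact: integrable_exp_linear_gauss.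
move=> p; rewrite ger0_norm ?mulr_ge0 ?expR_ge0// -!mulrDl ler_wpM2r ?gauss2_ge0//.
rewrite !expRD.
set a := k * p.1; set b := k * p.2.
have -> : - k * p.1 = - a by rewrite mulNr.
have -> : - k * p.2 = - b by rewrite mulNr.
have ea (t : R) : expR `|t| <= expR t + expR (- t).
  have [t0|t0] := leP 0 t; [rewrite ger0_norm//|rewrite ltr0_norm//].
    by rewrite lerDl expR_ge0.
  by rewrite lerDr expR_ge0.
apply: (@le_trans _ _ (expR `|a| * expR `|b|)); last first.
  apply: (le_trans (ler_pM (expR_ge0 _) (expR_ge0 _) (ea a) (ea b))).
  by rewrite mulrDl !mulrDr.
rewrite -expRD ler_expR /a /b !normrM -mulrDr.
apply: (@le_trans _ _ (`|k| * normc (p.1 +i* p.2))).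
  by rewrite ler_wpM2r ?normc_ge0// ler_norm.
by rewrite ler_wpM2l//; exact: ler_normc_ReIm.
Qed.

(** Quantifying over every k absorbs the exponential factors produced by coherent vectors and by
    translations. The argument p.1 -i* p.2 is conj u, in keeping with the representation of
    vectors. *)
Definition gaussian_growth f := entire f /\ forall k : R,
  leb2.-integrable setT (fun p => (normc (f (p.1 -i* p.2)) *
    (expR (k * normc (p.1 +i* p.2)) * gauss2 p))%:E).

Lemma measurable_growth f (k : R) : entire f -> measurable_fun setT
  (fun p => normc (f (p.1 -i* p.2)) * (expR (k * normc (p.1 +i* p.2)) * gauss2 p)).
Proof.
move=> ef; apply: measurable_funM; last exact: measurable_exp_gauss.
exact: measurableC_normc (measurableC_entire ef).2.
Qed.

Lemma gaussian_growth_le f h (k K : R) : gaussian_growth f -> entire h ->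
  (forall z, normc (h z) <= K * expR (k * normc z) * normc (f z)) ->
  gaussian_growth h.
Proof.
move=> [ef gf] eh hf; split=> // l.
apply: (integrable_plane_le (measurable_growth l eh) (integrable_planeZ K (gf (k + l)))).
move=> p; have u0 := expR_ge0 (l * normc (p.1 +i* p.2)).
have g0 := gauss2_ge0 p.
rewrite ger0_norm; last by rewrite !mulr_ge0 ?normc_ge0.
have := hf (p.1 -i* p.2); rewrite (_ : normc (p.1 -i* p.2) = normc (p.1 +i* p.2)); last first.
  by rewrite -[RHS]normcJ.
set u := normc (p.1 +i* p.2) in u0 *.
move=> H; apply: (le_trans (ler_wpM2r (mulr_ge0 u0 g0) H)).
by rewrite mulrDl expRD le_eqVlt; apply/orP; left; apply/eqP; ring.
Qed.

Lemma gaussian_growthM f h (k K : R) : gaussian_growth f -> entire h ->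
  (forall z, normc (h z) <= K * expR (k * normc z)) ->
  gaussian_growth (fun z => h z * f z).
Proof.
move=> gf eh hK; apply: (gaussian_growth_le gf (entireM eh gf.1)) => z.
by rewrite normcM ler_wpM2r ?normc_ge0.
Qed.

Lemma entire_cexp_affine (a b : C) : entire (fun z => cexp (a * z + b)).
Proof.
by have := @entire_comp R (@cexp R) (fun z => a * z + b) (@entire_cexp R) (@entire_affine R a b).
Qed.

Lemma normc_cexp_affine (a b z : C) :
  normc (cexp (a * z + b)) <= expR (normc b) * expR (normc a * normc z).
Proof.
apply: (le_trans (normc_cexp_le _)).
by rewrite -expRD ler_expR addrC -normcM le_normcD.
Qed.

Lemma gaussian_growth_cexp f (a b : C) : gaussian_growth f ->
  gaussian_growth (fun z => cexp (a * z + b) * f z).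
Proof.
move=> gf; apply: (gaussian_growthM gf (@entire_cexp_affine a b)) => z.
exact: normc_cexp_affine.
Qed.

(** From x y <= x ^ 2 + y ^ 2 with x = |f (conj u)| and y = exp (k |u|): the square of x is
    integrable by membership in the space, that of y by [integrable_exp_gauss]. *)
Lemma gaussian_growth_bargmann f : bargmann f -> gaussian_growth f.
Proof.
move=> [ef sf]; split=> // k.
pose G p := pi * (normc (f (p.1 -i* p.2)) ^+ 2 * gauss (p.1 +i* p.2)) +
   expR ((2 * k) * normc (p.1 +i* p.2)) * gauss2 p.
apply: (@integrable_plane_le _ _ G (measurable_growth k ef)).
  by apply: integrable_planeD; [exact: integrable_planeZ|exact: integrable_exp_gauss].
move=> p; rewrite ger0_norm; last by rewrite !mulr_ge0 ?normc_ge0 ?expR_ge0.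
have pi0 : pi != 0 :> R by rewrite gt_eqF// pi_gt0.
rewrite /G gaussE (_ : pi * _ = normc (f (p.1 -i* p.2)) ^+ 2 * gauss2 p); last first.
  by rewrite [LHS]mulrC -!mulrA mulVf// mulr1.
rewrite mulrA -mulrDl ler_wpM2r ?gauss2_ge0//.
rewrite -mulrA (mulrC 2) mulr_natr mulr2n expRD.
move: (normc_ge0 (f (p.1 -i* p.2))) (expR_ge0 (k * normc (p.1 +i* p.2))).
set x := normc _; set y := expR _ => x0 y0.
by have := sqr_ge0 (x - y); have := sqr_ge0 x; have := sqr_ge0 y; rewrite sqrrB; nra.
Qed.

(* Translating the plane by the conjugate of b decreases |u|^2 by at most
   2 |b| |u|, which the factor expR (k * |u|) absorbs. *)
Lemma gaussian_growth_translation f (b : C) : gaussian_growth f ->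
  gaussian_growth (fun z => f (z + b)).
Proof.
move=> [ef gf].
have eh : entire (fun z => f (z + b)).
  have := entire_comp ef (@entire_affine R 1 b).
  congr entire; apply/funext => z; by rewrite mul1r.
split=> // k.
pose B := normc b; pose x := complex.Re b; pose y := complex.Im b.
pose G p := normc (f (p.1 -i* p.2)) *
   (expR (k * normc ((p.1 - x) +i* (p.2 + y))) * gauss2 (p.1 - x, p.2 + y)).
have mG : measurable_fun setT G.
  have mT := (plane_preserving_translation (- x) y).1.
  apply: measurable_funM.
    exact: measurableC_normc (measurableC_entire ef).2.
  exact: (measurableT_comp (measurable_exp_gauss k) mT).
have iG : leb2.-integrable setT (fun p => (G p)%:E).
  (* The constants come from k |u - conj b| <= |k| (|u| + B) and |u - conj b| ^ 2 >= |u| ^ 2 - 2 B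
     |u|. *)
  apply: (integrable_plane_le mG (integrable_planeZ (expR (`|k| * B)) (gf (`|k| + 2 * B)))).
  move=> p; rewrite ger0_norm; last by rewrite !mulr_ge0 ?normc_ge0 ?expR_ge0.
  have gE : gauss2 (p.1 - x, p.2 + y) = expR (- normc ((p.1 - x) +i* (p.2 + y)) ^+ 2).
    exact: gauss2_normc.
  rewrite /G [leRHS]mulrCA ler_wpM2l ?normc_ge0// gE gauss2_normc -!expRD ler_expR.
  set u := p.1 +i* p.2.
  have -> : (p.1 - x) +i* (p.2 + y) = u - b^*%C.
    by rewrite /u /x /y; case: (b) => bx by_; apply: eqc => /=; ring.
  have h1 : normc (u - b^*%C) <= normc u + B.
    by apply: (le_trans (le_normcD _ _)); rewrite normcN normcJ.
  have h2 : normc u <= normc (u - b^*%C) + B.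
    by rewrite -[X in normc X <= _](subrK b^*%C); apply: (le_trans (le_normcD _ _)); rewrite normcJ.
  have h3 : k * normc (u - b^*%C) <= `|k| * (normc u + B).
    apply: (@le_trans _ _ (`|k| * normc (u - b^*%C))).
      by rewrite ler_wpM2r ?normc_ge0// ler_norm.
    by rewrite ler_wpM2l.
  have h4 : normc u ^+ 2 - 2 * B * normc u <= normc (u - b^*%C) ^+ 2.
    have aux (U V W : R) : 0 <= U -> 0 <= V -> U <= V + W -> U ^+ 2 - 2 * W * U <= V ^+ 2.
      move=> U0 V0 UVW; have [WU|UW] := leP W U; last by nra.
      have : (U - W) ^+ 2 <= V ^+ 2 by rewrite ler_pXn2r ?nnegrE ?subr_ge0// lerBlDr.
      by nra.
    by apply: aux; rewrite ?normc_ge0.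
  by lra.
have := integrable_plane_translation x (- y) iG.
congr integrable; apply/funext => p; congr EFin; rewrite /G /=.
rewrite !addrK !subrK -surjective_pairing; congr (normc (f _) * _).
have E (s t : R) : (s + x) -i* (t - y) = s -i* t + b.
  by rewrite /x /y; case: (b) => bx by_; apply: eqc => //=; rewrite opprB addrC.
exact: E.
Qed.

Lemma growth_integrableC f (c : C) : gaussian_growth f ->
  measurableC (fun p => f (p.1 -i* p.2) * cexp (c * (p.1 +i* p.2)) * (gauss2 p)%:C) /\
  integrableC (fun p => f (p.1 -i* p.2) * cexp (c * (p.1 +i* p.2)) * (gauss2 p)%:C).
Proof.
move=> [ef gf].
have mF : measurableC (fun p => f (p.1 -i* p.2) * cexp (c * (p.1 +i* p.2)) * (gauss2 p)%:C).
  have m1 := (measurableC_entire ef).2.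
  have := (measurableC_entire (@entire_cexp_affine c 0)).1.
  rewrite (_ : (fun p => _) = fun p => cexp (c * (p.1 +i* p.2))); last first.
    by apply/funext => p; rewrite addr0.
  move=> m2; exact: (measurableCM (measurableCM m1 m2) (measurableC_real (@measurable_gauss2 R))).
split=> //; apply: (integrableC_le mF (gf (normc c))) => p.
rewrite !normcM normcR (ger0_norm (gauss2_ge0 p)) -mulrA.
rewrite ler_wpM2l ?normc_ge0// ler_wpM2r ?gauss2_ge0//.
by rewrite -normcM normc_cexp_le.
Qed.

Lemma reproducing f (c : C) : gaussian_growth f ->
  integralC (fun p => f (p.1 -i* p.2) * cexp (c * (p.1 +i* p.2)) * (gauss2 p)%:C)
    = pi%:C * f c.
Proof.
move=> gf.
have [mF _] := growth_integrableC c gf.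
have pT := plane_preserving_translation (complex.Re c) (- complex.Im c).
rewrite -(integralC_preserving pT mF).
(* Expanding |u + conj c| ^ 2 cancels the factor exp (c (u + conj c)) and leaves exp (- conj c conj
   u) besides the Gaussian. What remains is again an entire function of conj u, with h 0 = f c. *)
pose h z := cexp (- c^*%C * z + 0) * f (z + c).
have gh : gaussian_growth h.
  exact/gaussian_growth_cexp/gaussian_growth_translation.
have ih : integrableC (fun p => h (p.1 -i* p.2) * (gauss2 p)%:C).
  have := (growth_integrableC 0 gh).2.
  by congr integrableC; apply/funext => p; rewrite mul0r cexp0 mulr1.
have := plane_mean gh.1 ih; rewrite {2}/h mulr0 add0r add0r cexp0 mul1r => <-.
congr integralC; apply/funext => p /=; rewrite /h addr0.
have -> : (p.1 + complex.Re c) -i* (p.2 - complex.Im c) = p.1 -i* p.2 + c.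
  by case: (c) => a b; apply: eqc => /=; ring.
have gE q : (gauss2 q)%:C = cexp (- (q.1 +i* q.2) * (q.1 -i* q.2)).
  by rewrite /gauss2 -cexpR; congr cexp; apply: eqc => /=; ring.
rewrite !gE -mulrA -cexpD [RHS]mulrAC -cexpD [RHS]mulrC; congr (_ * cexp _).
by case: (c) => a b; apply: eqc => /=; ring.
Qed.

End Reproducing.

(** * The power series of the complex exponential *)

Section ExponentialSeries.
Context {R : realType}.
Local Notation C := R[i].
Implicit Types z w : C.

Definition cexp_coeff z (n : nat) : C := z ^+ n / (n`!%:R : R)%:C.

Lemma factC_neq0 n : ((n`!%:R : R)%:C : C) != 0.
Proof. by rewrite eq_complex /= eqxx andbT pnatr_eq0 -lt0n fact_gt0. Qed.

Lemma normc_cexp_coeff z n : normc (cexp_coeff z n) = exp_coeff (normc z) n.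
Proof. by rewrite /cexp_coeff /exp_coeff /= normcM normcX normcV normcR ger0_norm. Qed.

Lemma has_cderivX (n : nat) w : has_cderiv (fun z => z ^+ n.+1) w (n.+1%:R * w ^+ n).
Proof.
elim: n => [|n IH].
  have := @has_cderiv_affine R 1 0 w.
  rewrite expr0 mulr1; congr has_cderiv.
  by apply/funext => z; rewrite mul1r addr0 expr1.
have := has_cderivM (@has_cderiv_affine R 1 0 w) IH.
rewrite (_ : (fun z => _) = fun z => z ^+ n.+2); last first.
  by apply/funext => z; rewrite mul1r addr0 -exprS.
by congr has_cderiv; rewrite !exprS -[n.+2%:R]natr1; ring.
Qed.

Lemma has_cderiv_partial_exp n w :
  has_cderiv (fun z => \sum_(0 <= k < n.+1) cexp_coeff z k) w
    (\sum_(0 <= k < n) cexp_coeff w k).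
Proof.
elim: n => [|n IH].
  rewrite big_geq//; have := @has_cderiv_cst R 1 w.
  congr has_cderiv; apply/funext => z.
  by rewrite big_nat1 /cexp_coeff expr0 mul1r /cst fact0 invr1.
have D : has_cderiv (fun z => cexp_coeff z n.+1) w (cexp_coeff w n).
  have := has_cderivM (has_cderivX n w) (@has_cderiv_cst R ((n.+1`!%:R : R)%:C)^-1 w).
  congr has_cderiv.
  have f0 := factC_neq0 n.
  have n0 : (n.+1%:R : C) != 0 by rewrite pnatr_eq0.
  rewrite /cst mulr0 addr0 /cexp_coeff factS natrM rmorphM/= rmorph_nat.
  move: f0 n0; move: ((n`!%:R : R)%:C) (n.+1%:R : C) => F N F0 N0.
  by field; rewrite F0 N0.
have := has_cderivD IH D.
rewrite -big_nat_recr//=; congr has_cderiv; apply/funext => z.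
by rewrite [RHS]big_nat_recr.
Qed.

(** The real mean value theorem on the segment from 0 to z, applied to both components; the factor 2
    comes from bounding them separately. *)
Lemma has_cderiv_increment_le (f f' : C -> C) z (M : R) :
  (forall w, has_cderiv f w (f' w)) ->
  (forall t : R, t \in `[0, 1] -> normc (f' (t%:C * z)) <= M) ->
  normc (f z - f 0) <= 2 * (M * normc z).
Proof.
move=> Hf HM.
have D t := has_cderiv_line (Hf (0 + t%:C * z)).
have bound t : t \in `[0, 1] -> normc (f' (0 + t%:C * z) * z) <= M * normc z.
  by move=> t01; rewrite add0r normcM ler_wpM2r ?normc_ge0// HM.
have e1 : f z - f 0 = f (0 + (1 : R)%:C * z) - f (0 + (0 : R)%:C * z).
  by rewrite !add0r mul1r mul0r.
rewrite e1; apply: (le_trans (ler_normc_ReIm _)).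
rewrite mulr_natl mulr2n cReD cImD cReN cImN; apply: lerD.
- have H2 (t : R) : t \in `[0, 1] ->
      `|complex.Re (f' (0 + t%:C * z) * z) - (0 + 0 * t)| <= M * normc z.
    by move=> t01; rewrite mul0r addr0 subr0; apply: (le_trans (ler_Re_normc _)); exact: bound.
  have := increment_approx ler01 (fun t _ => (D t).1) H2.
  by rewrite !mul0r !addr0 !subr0 mulr1.
- have H2 (t : R) : t \in `[0, 1] ->
      `|complex.Im (f' (0 + t%:C * z) * z) - (0 + 0 * t)| <= M * normc z.
    by move=> t01; rewrite mul0r addr0 subr0; apply: (le_trans (ler_Im_normc _)); exact: bound.
  have := increment_approx ler01 (fun t _ => (D t).2) H2.
  by rewrite !mul0r !addr0 !subr0 mulr1.
Qed.

(** Let S be the partial sum up to the power n. The derivative of exp (- w) S w telescopes to - exp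
    (- w) w ^ n / n!, so exp (- z) S z differs from its value 1 at 0 by a multiple of |z| ^ n / n!,
    which tends to 0. *)
Lemma normc_cexp_series z :
  (fun n => normc (\sum_(0 <= k < n) cexp_coeff z k - cexp z)) @ \oo --> (0 : R).
Proof.
(* The shift makes the partial sum end with the term of index n and so contain the constant term,
   which gives f 0 = 1. *)
rewrite -cvg_shiftS.
pose K := 2 * (expR (normc z) * expR (normc z)) * normc z.
have K0 : 0 <= K by rewrite !mulr_ge0 ?expR_ge0 ?normc_ge0.
have lim : (fun n => K * exp_coeff (normc z) n) @ \oo --> (0 : R).
  rewrite -[X in _ --> X](mulr0 K); apply: cvgMr.
  exact: cvg_exp_coeff.
apply: (squeeze_cvgr _ (cvg_cst 0) lim); near=> n; rewrite normc_ge0/=.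
pose f w := cexp (- 1 * w + 0) * \sum_(0 <= k < n.+1) cexp_coeff w k.
pose f' w := - (cexp (- w) * cexp_coeff w n).
have Hf w : has_cderiv f w (f' w).
  have H1 := @has_cderiv_comp R (@cexp R) (fun w => -1 * w + 0) w _ _ (@has_cderiv_cexp R (-1 * w + 0)) (@has_cderiv_affine R (-1) 0 w).
  have := has_cderivM H1 (has_cderiv_partial_exp n w).
  congr has_cderiv; rewrite /f' big_nat_recr//= addr0 mulN1r; ring.
have HM (t : R) : t \in `[0, 1] -> normc (f' (t%:C * z)) <=
    expR (normc z) * exp_coeff (normc z) n.
  rewrite in_itv/= => /andP[t0 t1].
  have tz : normc (t%:C * z) <= normc z.
    by rewrite normcM normcR ger0_norm// ler_piMl ?normc_ge0.
  rewrite /f' normcN normcM normc_cexp_coeff; apply: ler_pM.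
  - exact: normc_ge0.
  - by rewrite exp_coeff_ge0 ?normc_ge0.
  - by apply: (le_trans (normc_cexp_le _)); rewrite normcN ler_expR.
  - rewrite /exp_coeff /= ler_wpM2r ?invr_ge0// lerXn2r ?nnegrE ?normc_ge0//.
have := has_cderiv_increment_le Hf HM.
have f0 : f 0 = 1.
  rewrite /f mulr0 addr0 cexp0 mul1r big_nat_recl//= big1 ?addr0.
    by rewrite /cexp_coeff expr0 mul1r fact0 invr1.
  by move=> k _; rewrite /cexp_coeff expr0n/= mul0r.
rewrite f0 /f addr0 mulN1r => H.
rewrite (_ : _ - cexp z = cexp z *
  (cexp (- z) * \sum_(0 <= k < n.+1) cexp_coeff z k - 1)); last first.
  by rewrite mulrBr mulr1 mulrA cexpNK mul1r.
rewrite normcM; apply: (le_trans (ler_pM (normc_ge0 _) (normc_ge0 _) (normc_cexp_le z) H)).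
by rewrite /K le_eqVlt; apply/orP; left; apply/eqP; ring.
Unshelve. all: by end_near. Qed.

Lemma cexp_series z : series (cexp_coeff z) @ \oo --> cexp z.
Proof. exact: cvgC_normc (normc_cexp_series z). Qed.

Lemma series_exp_coeff_le (x : R) n : 0 <= x -> series (exp_coeff x) n <= expR x.
Proof.
move=> x0; have := @nondecreasing_cvgn_le R (series (exp_coeff x)).
apply; last exact: is_cvg_series_exp_coeff.
by apply/nondecreasing_seqP => k; rewrite seriesSr lerDl exp_coeff_ge0.
Qed.

Lemma normc_cexp_coeff_le z n : normc (cexp_coeff z n) <= expR (normc z).
Proof.
rewrite normc_cexp_coeff.
apply: le_trans (series_exp_coeff_le n.+1 (normc_ge0 z)).
rewrite seriesSr lerDr /series /=; apply: sumr_ge0 => k _.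
by rewrite exp_coeff_ge0 ?normc_ge0.
Qed.

Lemma normc_partial_exp_le z n :
  normc (\sum_(0 <= k < n) cexp_coeff z k) <= expR (normc z).
Proof.
apply: (le_trans (normc_sum_le _ _)).
under eq_bigr do rewrite normc_cexp_coeff.
exact: series_exp_coeff_le (normc_ge0 z).
Qed.

End ExponentialSeries.

(** * Displacements, coherent vectors and the basis of the Bargmann space *)

Section BargmannSpace.
Context {R : realType}.
Local Notation C := R[i].
Local Notation leb2 := (@lebesgue_measure R \x @lebesgue_measure R)%E.
Implicit Types (f h psi k : C -> C) (a alpha w : C).

Lemma measurable_entire_gauss k h : entire k -> entire h ->
  measurableC (fun p => (k (p.1 -i* p.2))^*%C * h (p.1 -i* p.2) * (gauss (p.1 +i* p.2))%:C).
Proof.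
move=> ek eh.
have m1 := measurableC_conj (measurableC_entire ek).2.
have m2 := (measurableC_entire eh).2.
have m3 : measurable_fun setT (fun p : R * R => gauss (p.1 +i* p.2)).
  rewrite (_ : (fun p => _) = fun p => gauss2 p * pi^-1); last first.
    by apply/funext => p; rewrite gaussE.
  by apply: measurable_funM; [exact: measurable_gauss2|exact: measurable_cst].
exact: (measurableCM (measurableCM m1 m2) (measurableC_real m3)).
Qed.

Lemma entire_displacement alpha f : entire f -> entire (displacement alpha f).
Proof.
move=> ef.
have e1 := @entire_cexp_affine R alpha 0.
have e2 := entire_comp ef (@entire_affine R 1 (- alpha^*%C)).
have := @entireZ R (expR (- normc alpha ^+ 2 / 2))%:C _ (entireM e1 e2).
congr entire; apply/funext => w.
by rewrite /displacement addr0 mul1r mulrA.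
Qed.

(** Pointwise form of unitarity: - |alpha| ^ 2 + 2 Re (alpha conj u) - |u| ^ 2 = - |u - alpha| ^ 2,
    so a displacement merely translates the density of the squared norm. *)
Lemma square_displacement alpha f (p : R * R) :
  normc (displacement alpha f (p.1 -i* p.2)) ^+ 2 * gauss (p.1 +i* p.2) =
  normc (f ((p.1 - complex.Re alpha) -i* (p.2 - complex.Im alpha))) ^+ 2 *
    gauss ((p.1 - complex.Re alpha) +i* (p.2 - complex.Im alpha)).
Proof.
case: alpha p => [x y] [s t] /=; rewrite /displacement !normcM.
rewrite (_ : s -i* t - _ = (s - x) -i* (t - y)); last first.
  by apply: eqc => /=; ring.
rewrite exprMn mulrAC [RHS]mulrC; congr (_ * _).
rewrite /gauss mulrA; congr (_ / _).
rewrite normcR ger0_norm ?expR_ge0// normc_cexp -expRD -expRM_natl -expRD.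
by congr expR; rewrite !normc_sqr /=; field.
Qed.

Lemma bargmann_displacement alpha f : bargmann f -> bargmann (displacement alpha f).
Proof.
move=> [ef sf]; split; first exact: entire_displacement.
have := integrable_plane_translation (- complex.Re alpha) (- complex.Im alpha) sf.
congr integrable; apply/funext => p; congr EFin.
exact/esym/square_displacement.
Qed.

Lemma gauss_cexp (u : C) : (gauss u)%:C = cexp (- (u * u^*%C)) / pi%:C.
Proof.
rewrite /gauss rmorphM/= fmorphV/= normc_sqr -cexpR; congr (cexp _ / _).
by case: u => x y; apply: eqc => /=; ring.
Qed.

(* Both integrands are the same up to translation by alpha. *)
Lemma inner_displacement alpha k psi : entire k -> entire psi ->
  inner k (displacement (- alpha) psi) = inner (displacement alpha k) psi.
Proof.
move=> ek epsi.
have mF := measurable_entire_gauss (entire_displacement (alpha := alpha) ek) epsi.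
have pT := plane_preserving_translation (complex.Re alpha) (complex.Im alpha).
rewrite /inner; apply: etrans (integralC_preserving pT mF).
congr integralC; apply/funext => p; move: p.1 p.2 => s t /=.
set u := s +i* t.
have -> : (s + complex.Re alpha) +i* (t + complex.Im alpha) = u + alpha.
  by apply: eqc => /=; rewrite ?cReD ?cImD.
have -> : (s + complex.Re alpha) -i* (t + complex.Im alpha) = u^*%C + alpha^*%C.
  by rewrite -rmorphD/= /u; case: (alpha).
have -> : s -i* t = u^*%C by [].
have cM (a b : C) : (a * b)^*%C = a^*%C * b^*%C by exact: rmorphM.
have cD (a b : C) : (a + b)^*%C = a^*%C + b^*%C by exact: rmorphD.
have cN (a : C) : (- a)^*%C = - a^*%C by exact: rmorphN.
rewrite /displacement addrK normcN cN opprK !cM conjc_real -cexpJ.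
rewrite !gauss_cexp cM !cD !conjcK.
have E : cexp (- alpha * u^*%C) * cexp (- (u * u^*%C)) =
    cexp (alpha^*%C * (u + alpha)) * cexp (- ((u + alpha) * (u^*%C + alpha^*%C))).
  by rewrite -!cexpD; congr cexp; ring.
transitivity ((k u^*%C)^*%C * (expR (- normc alpha ^+ 2 / 2))%:C * psi (u^*%C + alpha^*%C) *
  (cexp (- alpha * u^*%C) * cexp (- (u * u^*%C))) / pi%:C); first by ring.
by rewrite E; ring.
Qed.

(** The reproducing kernel of the space at w, an unnormalised coherent vector. *)
Definition coherent w (z : C) : C := cexp (w^*%C * z).

Lemma bargmann_coherent w : bargmann (coherent w).
Proof.
split.
  have := @entire_cexp_affine R w^*%C 0.
  by congr entire; apply/funext => z; rewrite addr0.
have := integrable_planeZ pi^-1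
  (integrable_exp_linear_gauss (2 * complex.Re w) (- (2 * complex.Im w))).
congr integrable; apply/funext => p; congr EFin.
have E (s t : R) : expR (2 * complex.Re w * s + - (2 * complex.Im w) * t) =
    normc (coherent w (s -i* t)) ^+ 2.
  rewrite /coherent normc_cexp -expRM_natl; congr expR.
  by case: w => x y /=; ring.
by rewrite E [RHS]mulrC mulrC gaussE; ring.
Qed.

Lemma inner_coherent h w : bargmann h -> inner (coherent w) h = h w.
Proof.
move=> bh; have gh := gaussian_growth_bargmann bh.
have pi0 : pi != 0 :> R by rewrite gt_eqF// pi_gt0.
have := integralCZ (pi^-1)%:C (growth_integrableC w gh).2.
rewrite reproducing// mulrA -rmorphM/= mulVf// mul1r => <-.
rewrite /inner; congr integralC; apply/funext => p.
transitivity ((cexp (w^*%C * (p.1 +i* p.2)^*%C))^*%C * h (p.1 -i* p.2) *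
  (gauss (p.1 +i* p.2))%:C); first by [].
have cM (a b : C) : (a * b)^*%C = a^*%C * b^*%C by exact: rmorphM.
by rewrite -cexpJ cM !conjcK gaussE rmorphM; ring.
Qed.

(* The adjoint is determined by its inner products with the coherent vectors,
   which are its values. *)
Lemma adjoint_displacement alpha psi : bargmann psi ->
  adjoint (displacement alpha) psi = displacement (- alpha) psi.
Proof.
move=> bpsi; apply: xget_unique.
  split; first exact: bargmann_displacement.
  by move=> k bk; apply: inner_displacement; [case: bk|case: bpsi].
move=> h [bh Hh]; apply/funext => w.
rewrite -(inner_coherent w bh) Hh; last exact: bargmann_coherent.
rewrite -inner_displacement; first last.
- by case: bpsi.
- by case: (bargmann_coherent w).
by rewrite inner_coherent//; exact: bargmann_displacement.
Qed.

(** The two factors sqrt n! combine, so sums over products of kets become exponential series; all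
    three series of the theorem are handled in this way. *)
Lemma ket_mul n w a : ket n w * ket n a = cexp_coeff (w * a) n.
Proof.
by rewrite /ket /cexp_coeff mulrACA -exprMn -invfM -rmorphM/= -expr2 sqr_sqrtr.
Qed.

Lemma ketJ n w : (ket n w)^*%C = ket n w^*%C.
Proof.
have cM (a b : C) : (a * b)^*%C = a^*%C * b^*%C by exact: rmorphM.
have cX (a : C) : (a ^+ n)^*%C = a^*%C ^+ n by exact: rmorphXn.
have cV (a : C) : (a^-1)^*%C = (a^*%C)^-1 by exact: fmorphV.
by rewrite /ket cM cX cV conjc_real.
Qed.

(** The value [ket n 1] serves as a name for 1 / sqrt n!, which allows normalisations to be
    exchanged through [ket_mul]. *)
Lemma ket1_neq0 n : ket n 1 != 0 :> C.
Proof.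
by rewrite /ket expr1n mul1r invr_eq0 eq_complex /= eqxx andbT gt_eqF//
  sqrtr_gt0 ltr0n fact_gt0.
Qed.

Lemma growth_cexp_coeff h a n : gaussian_growth h ->
  let F (p : R * R) := h (p.1 -i* p.2) * cexp_coeff (a * (p.1 +i* p.2)) n * (gauss2 p)%:C in
  measurableC F /\ integrableC F.
Proof.
move=> gh F.
have mF : measurableC F.
  have mu : measurableC (fun p => p.1 +i* p.2 : C).
    by split; [exact: measurable_fst|exact: measurable_snd].
  have mX := measurableCX n (measurableCM (measurableC_cst a) mu).
  have mc := measurableCM mX (measurableC_cst ((n`!%:R : R)%:C)^-1).
  exact: (measurableCM (measurableCM (measurableC_entire gh.1).2 mc)
    (measurableC_real (@measurable_gauss2 R))).
split=> //; apply: (integrableC_le mF (gh.2 (normc a))) => p.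
rewrite /F normcM normcM normcR ger0_norm ?gauss2_ge0// -mulrA ler_wpM2l ?normc_ge0//.
by rewrite ler_wpM2r ?gauss2_ge0// -(normcM a) normc_cexp_coeff_le.
Qed.

Lemma inner_ket n h : gaussian_growth h -> inner (ket n) h = (pi^-1)%:C * (ket n 1)^-1 *
  integralC (fun p => h (p.1 -i* p.2) * cexp_coeff (1 * (p.1 +i* p.2)) n * (gauss2 p)%:C).
Proof.
move=> gh; rewrite -integralCZ; last exact: (growth_cexp_coeff 1 n gh).2.
congr integralC; apply/funext => p.
transitivity ((ket n (p.1 +i* p.2)^*%C)^*%C * h (p.1 -i* p.2) *
  (gauss (p.1 +i* p.2))%:C); first by [].
rewrite ketJ conjcK gaussE rmorphM -ket_mul.
have := ket1_neq0 n; move: (ket n 1) => c c0.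
by rewrite [RHS](_ : _ = (c^-1 * c) *
  (ket n (p.1 +i* p.2) * h (p.1 -i* p.2) * ((gauss2 p)%:C * (pi^-1)%:C))); [rewrite mulVf// mul1r|ring].
Qed.

(** Multiplied by [ket n a], the n-th coefficient is 1 / pi times the Gaussian integral of h (conj
    u) against the n-th term of exp (a u). The partial sums are dominated through exp (|a| |u|), and
    the limit integral is pi h a by the reproducing property. Convergence is thus pointwise at a. *)
Lemma bargmann_expansion h a : bargmann h ->
  series (fun n => inner (ket n) h * ket n a) @ \oo --> h a.
Proof.
move=> bh; have gh := gaussian_growth_bargmann bh; have [eh _] := bh.
have pi0 : pi != 0 :> R by rewrite gt_eqF// pi_gt0.
pose F j (p : R * R) := h (p.1 -i* p.2) * cexp_coeff (a * (p.1 +i* p.2)) j * (gauss2 p)%:C.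
pose F_ n p := \sum_(0 <= j < n) F j p.
pose L (p : R * R) := h (p.1 -i* p.2) * cexp (a * (p.1 +i* p.2)) * (gauss2 p)%:C.
pose G (p : R * R) := normc (h (p.1 -i* p.2)) *
  (expR (normc a * normc (p.1 +i* p.2)) * gauss2 p).
have F_E n p : F_ n p = h (p.1 -i* p.2) *
    (\sum_(0 <= j < n) cexp_coeff (a * (p.1 +i* p.2)) j) * (gauss2 p)%:C.
  by rewrite /F_ /F -mulr_suml -mulr_sumr.
have iF j : integrableC (F j) := (growth_cexp_coeff a j gh).2.
have mF j : measurableC (F j) := (growth_cexp_coeff a j gh).1.
have SE : series (fun n => inner (ket n) h * ket n a) =
    fun n => (pi^-1)%:C * integralC (F_ n).
  apply/funext => n; rewrite (integralC_sum n iF).1 /series /= mulr_sumr.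
  apply: eq_bigr => j _; rewrite inner_ket// -mulrA -mulrA; congr (_ * _).
  rewrite (_ : F j = fun p => (ket j 1)^-1 * ket j a * (h (p.1 -i* p.2) *
      cexp_coeff (1 * (p.1 +i* p.2)) j * (gauss2 p)%:C)); last first.
    apply/funext => p; rewrite /F -!ket_mul.
    have := ket1_neq0 j; move: (ket j 1) => c c0.
    rewrite [RHS](_ : _ = (c^-1 * c) * (h (p.1 -i* p.2) *
      (ket j a * ket j (p.1 +i* p.2)) * (gauss2 p)%:C)); last by ring.
    by rewrite mulVf// mul1r.
  rewrite [in RHS]integralCZ; last exact: (growth_cexp_coeff 1 j gh).2.
  by ring.
have lim : (fun n => integralC (F_ n)) @ \oo --> integralC L.
  apply: (@dominated_cvgC R F_ L G).
  - by move=> n; exact: measurableC_sum.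
  - exact: (growth_integrableC a gh).1.
  - move=> p; rewrite (_ : (fun n => _) = fun n => normc (h (p.1 -i* p.2)) * gauss2 p *
      normc (\sum_(0 <= j < n) cexp_coeff (a * (p.1 +i* p.2)) j -
        cexp (a * (p.1 +i* p.2)))); last first.
      apply/funext => n; rewrite F_E /L -mulrBl -mulrBr !normcM normcR.
      by rewrite ger0_norm ?gauss2_ge0// mulrAC.
    rewrite -[X in _ --> X](mulr0 (normc (h (p.1 -i* p.2)) * gauss2 p)).
    by apply: cvgMr; exact: normc_cexp_series.
  - exact: gh.2.
  - move=> n p; rewrite F_E normcM normcM normcR ger0_norm ?gauss2_ge0// -mulrA.
    rewrite ler_wpM2l ?normc_ge0// ler_wpM2r ?gauss2_ge0// -(normcM a).
    exact: normc_partial_exp_le.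
rewrite SE (_ : h a = (pi^-1)%:C * integralC L); last first.
  by rewrite reproducing// mulrA -rmorphM/= mulVf// mul1r.
exact: cvgMr.
Qed.

End BargmannSpace.

(** As [sumC] and [integralC] have a value in every case, convergence of the three series and
    integrability of the integrand are asserted along with the identity. The closed forms confirm
    that the first two series represent the intended entire functions. *)
Theorem mainTheorem2 (R : realType) (g : R) (psi : R[i] -> R[i])
    (hpsi : bargmann psi) :
  let q : R[i] := (tanhR g)%:C in
  forall w0 w1 w2 : R[i],
  [/\ series (squeezed_term q w1 w2) @ \oo --> cexp (q * w1 * w2) /\
      Phi1 q psi w0 w1 w2 =
        (pi `^ (- 2^-1))%:C * (psi w0 * cexp (q * w1 * w2)),
      forall alpha : R[i], series (bell_term alpha w0 w1) @ \oo -->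
        (expR (- normc alpha ^+ 2 / 2))%:C *
        cexp (w0 * w1 - alpha^*%C * w1 + alpha * w0),
      forall alpha : R[i], cvgn (series (output_term q alpha psi w2)),
      integrableC (fun p : R * R => let alpha := p.1 +i* p.2 in
        sumC (bell_term alpha w0 w1) * sumC (output_term q alpha psi w2)) &
      Phi1 q psi w0 w1 w2 =
        (pi `^ (- (3 / 2)))%:C *
        integralC (fun p : R * R => let alpha := p.1 +i* p.2 in
          sumC (bell_term alpha w0 w1) * sumC (output_term q alpha psi w2))].
Proof.
move=> q w0 w1 w2.
have HS : series (squeezed_term q w1 w2) @ \oo --> cexp (q * w1 * w2).
  rewrite (_ : squeezed_term q w1 w2 = cexp_coeff (q * w1 * w2)).
    exact: cexp_series.
  apply/funext => n; rewrite /squeezed_term -mulrA ket_mul.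
  by rewrite /cexp_coeff mulrA -exprMn mulrA.
have HB alpha : series (bell_term alpha w0 w1) @ \oo -->
    (expR (- normc alpha ^+ 2 / 2))%:C * cexp (w0 * w1 - alpha^*%C * w1 + alpha * w0).
  have -> : (expR (- normc alpha ^+ 2 / 2))%:C *
      cexp (w0 * w1 - alpha^*%C * w1 + alpha * w0) =
    (expR (- normc alpha ^+ 2 / 2))%:C * cexp (alpha * w0) * cexp ((w0 - alpha^*%C) * w1).
    by rewrite -mulrA -cexpD; congr (_ * cexp _); ring.
  rewrite (_ : series _ = fun n => (expR (- normc alpha ^+ 2 / 2))%:C * cexp (alpha * w0) *
      series (cexp_coeff ((w0 - alpha^*%C) * w1)) n).
    by apply: cvgMr; exact: cexp_series.
  apply/funext => n; rewrite /series /= mulr_sumr; apply: eq_bigr => k _.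
  by rewrite /bell_term /displacement -mulrA ket_mul.
have HO alpha : series (output_term q alpha psi w2) @ \oo -->
    displacement (- alpha) psi (q * w2).
  (* The power of q is absorbed by the ket: q ^ n |n> at w2 is |n> at q w2. *)
  rewrite (_ : output_term q alpha psi w2 =
      fun n => inner (ket n) (displacement (- alpha) psi) * ket n (q * w2)).
    exact/bargmann_expansion/bargmann_displacement.
  apply/funext => n; rewrite /output_term adjoint_displacement// /ket exprMn.
  by ring.
have sumE (u : nat -> R[i]) l : series u @ \oo --> l -> sumC u = l.
  by move=> ul; apply: cvg_lim ul; exact: norm_hausdorff.
have PhiE : Phi1 q psi w0 w1 w2 =
    (pi `^ (- 2^-1))%:C * (psi w0 * cexp (q * w1 * w2)) by rewrite /Phi1 (sumE _ _ HS).
pose f z := cexp (- w1 * z + w0 * w1) * psi (z + q * w2).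
have gf : gaussian_growth f.
  by apply: gaussian_growth_cexp; apply: gaussian_growth_translation;
    exact: gaussian_growth_bargmann.
have FE : (fun p : R * R => let alpha := p.1 +i* p.2 in
    sumC (bell_term alpha w0 w1) * sumC (output_term q alpha psi w2)) =
  fun p => f (p.1 -i* p.2) * cexp ((w0 - q * w2) * (p.1 +i* p.2)) * (gauss2 p)%:C.
  apply/funext => p /=; rewrite (sumE _ _ (HB _)) (sumE _ _ (HO _)).
  set alpha := p.1 +i* p.2; have -> : p.1 -i* p.2 = alpha^*%C by [].
  (* One half of the Gaussian comes from the Bell vector, the other from the displaced psi. *)
  have -> : gauss2 p = expR (- normc alpha ^+ 2 / 2) * expR (- normc alpha ^+ 2 / 2).
    by rewrite gauss2_normc -expRD -splitr.
  have cN (a : R[i]) : (- a)^*%C = - a^*%C by exact: rmorphN.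
  rewrite /displacement /f normcN cN opprK rmorphM (addrC (q * w2)).
  set A := (expR _)%:C.
  transitivity (A * A * psi (alpha^*%C + q * w2) *
    (cexp (w0 * w1 - alpha^*%C * w1 + alpha * w0) * cexp (- alpha * (q * w2)))); first by ring.
  rewrite -cexpD (_ : w0 * w1 - alpha^*%C * w1 + alpha * w0 + - alpha * (q * w2) =
    - w1 * alpha^*%C + w0 * w1 + (w0 - q * w2) * alpha); last by ring.
  by rewrite cexpD; ring.
split; [by split|exact: HB| | |].
- by move=> alpha; apply/cvg_ex; eexists; exact: HO.
- by rewrite FE; exact: (growth_integrableC _ gf).2.
(* At c = w0 - q w2 the argument of psi becomes w0 and the exponent - w1 c + w0 w1 becomes q w1 w2.
   The factor pi of the reproducing property turns the power - 3 / 2 of pi into - 1 / 2. *)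
rewrite FE (reproducing _ gf) PhiE [RHS]mulrA -rmorphM /f subrK.
rewrite (_ : - w1 * _ + _ = q * w1 * w2); last by ring.
rewrite [cexp _ * _]mulrC; congr (_%:C * _).
rewrite -[X in _ = _ * X]powRr1 ?pi_ge0// -powRD; last first.
  by apply/implyP => _; rewrite gt_eqF// pi_gt0.
by congr (_ `^ _); field.
Qed.
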